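(* Let $c\ge 2$ be an integer and suppose that every agent $i\in N$ has a $\{1,c\}$-SUB valuation $v_i$. Let $\Psi$ be a justice criterion that satisfies (C1) and (C2), with gain function $\phi$ (i.e. $\phi$ is a finite-valued gain function for $\Psi$ satisfying (G1), (G2), (G3)). Then the Bivalued Yankee Swap algorithm, run with the gain function $\phi$, outputs a dominating $\Psi$-maximizing allocation.
   Context: **Setting.** $N=\{1,\dots,n\}$ is a set of agents and $G$ a finite set of $m$ goods. Write $S+g=S\cup\{g\}$, $S-g=S\setminus\{g\}$, $N+0=N\cup\{0\}$. For $v:2^G\to\mathbb{R}_{\ge0}$ let $\Delta_v(S,g)=v(S+g)-v(S)$. $v$ is $\{1,c\}$-SUB if $v(\emptyset)=0$; $\Delta_v(S,g)\in\{1,c\}$ for all $S\subseteq G$, $g\in G\setminus S$; and $\Delta_v(S,g)\ge\Delta_v(T,g)$ for all $S\subseteq T\subseteq G$, $g\in G\setminus T$. An allocation $X=(X_0,X_1,\dots,X_n)$ is a partition of $G$ into $n+1$ (possibly empty) bundles; $X_i$ goes to agent $i\in N$ and $X_0$ is unallocated. Its utility vector is $\vec u^X=(v_1(X_1),\dots,v_n(X_n))$; its sorted utility vector $\vec s^X$ is $\vec u^X$ sorted in ascending order. $\vec y\succ_{\mathrm{lex}}\vec z$ means there is $k\in[n]$ with $y_j=z_j$ for all $j<k$ and $y_k>z_k$. **Clean allocations and decompositions.** The dummy agent $0$ has valuation $v_0(S)=c|S|$. For $i\in N+0$ let $\beta_i(S)=\max\{|T|:T\subseteq S,\ v_i(T)=c|T|\}$.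 An allocation $X$ is clean if $\beta_i(X_i)=|X_i|$ for all $i\in N+0$. A decomposition of an allocation $X$ is a pair $(X^c,X^1)$ with $X^c=(X^c_0,\dots,X^c_n)$ a clean allocation and $X^1=(X^1_1,\dots,X^1_n)$ a tuple of disjoint bundles such that for each $i\in N$, $X_i$ is the disjoint union of $X_i^c$ and $X_i^1$, and $|X^c_i|=\beta_i(X_i)$ (a decomposition always exists). For a clean allocation $X^c$ and a tuple $X^1$ of disjoint subsets of $X^c_0$, $X^c\cup X^1$ denotes the allocation giving $X^c_i\cup X^1_i$ to each $i\in N$ and leaving the rest unallocated. **Domination.** With decompositions $X=X^c\cup X^1$, $Y=Y^c\cup Y^1$, $X$ dominates $Y$ if (a) $\vec s^{X^c}\succ_{\mathrm{lex}}\vec s^{Y^c}$; or (b) $\vec s^{X^c}=\vec s^{Y^c}$ and $\vec u^{X^c}\succ_{\mathrm{lex}}\vec u^{Y^c}$; or (c) $\vec u^{X^c}=\vec u^{Y^c}$ and $\vec u^X\succ_{\mathrm{lex}}\vec u^Y$. (This does not depend on the chosen decompositions, since $v_i(X_i^c)=c\beta_i(X_i)$.) **Justice criteria.** A justice criterion $\Psi$ is a total preorder $\succeq_\Psi$ on $\mathbb{Z}^n_{\ge0}$, with strict part $\succ_\Psi$ and indifference $=_\Psi$; allocations are compared via utility vectors. An allocation is $\Psi$-maximizing if no allocation $Y$ has $\vec u^Y\succ_\Psi\vec u^X$. A $\Psi$-maximizing allocation is a dominating $\Psi$-maximizing allocation if no other $\Psi$-maximizing allocation dominates it. A gain function $\phi$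 assigns a real number $\phi(\vec x,i,d)$ to each $\vec x\in\mathbb{Z}^n_{\ge0}$, $i\in N$, $d\in\{1,c\}$; write $\phi(X,i,d)=\phi(\vec u^X,i,d)$. Conditions: - (C1) For $\vec x,\vec y\in\mathbb{Z}^n_{\ge0}$ with ascending sortings $s(\vec x),s(\vec y)$: if $s(\vec x)_i\ge s(\vec y)_i$ for all $i$ then $\vec x\succeq_\Psi\vec y$, with $\vec x=_\Psi\vec y$ (in this situation) iff $s(\vec x)=s(\vec y)$. - (C2) $\Psi$ admits a finite-valued gain function $\phi$ satisfying: (G1) for $\vec x\in\mathbb{Z}^n_{\ge0}$, $i,j\in N$, $d_1,d_2\in\{1,c\}$, let $\vec y$ be $\vec x$ with $d_1$ added to $x_i$ and $\vec z$ be $\vec x$ with $d_2$ added to $x_j$; if $\phi(\vec x,i,d_1)\ge\phi(\vec x,j,d_2)$ then $\vec y\succeq_\Psi\vec z$, with $\vec y=_\Psi\vec z$ iff $\phi(\vec x,i,d_1)=\phi(\vec x,j,d_2)$; (G2) if $x_i\le y_i$ then $\phi(\vec x,i,d)\ge\phi(\vec y,i,d)$ for $d\in\{1,c\}$, with equality if $x_i=y_i$; (G3) if $x_i\le x_j$ then $\phi(\vec x,i,d)\ge\phi(\vec x,j,d)$ for $d\in\{1,c\}$, with equality iff $x_i=x_j$. **Exchange graph.** For a clean allocation $X$, the exchange graph $\mathcal G(X)$ is the directed graph on $G$ with an edge $g\to g'$ if $g\in X_j$ and $\beta_j(X_j-g+g')=\beta_j(X_j)$ for some $j\in N+0$. $F_i(X)=\{g\in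 G:\beta_i(X_i+g)-\beta_i(X_i)=1\}$. **Bivalued Yankee Swap.** Initialize $X^c=(G,\emptyset,\dots,\emptyset)$, $X^1=(\emptyset,\dots,\emptyset)$, $U=N$. While $\sum_{h\in N}|X^1_h|<|X^c_0|$, perform one iteration: let $\mathrm{Gain}_c=\max_{k\in U}\phi(X^c\cup X^1,k,c)$ ($-\infty$ if $U=\emptyset$) and $\mathrm{Gain}_1=\max_{k\in N\setminus U}\phi(X^c\cup X^1,k,1)$ ($-\infty$ if $N\setminus U=\emptyset$). - If $\mathrm{Gain}_c\ge\mathrm{Gain}_1$: choose the smallest-index $i\in U$ attaining $\mathrm{Gain}_c$. If there is a path in $\mathcal G(X^c)$ from $F_i(X^c)$ to $X^c_0$, take a shortest such path $(g'_1,\dots,g'_t)$ and update $X^c$ by moving $g'_{s+1}$ to the bundle that contained $g'_s$ for $1\le s<t$, and moving $g'_1$ to $X^c_i$ (so $g'_t$ leaves $X^c_0$); if $g'_t\in X^1_j$ for some $j\in N$, replace $X^1_j$ by $X^1_j-g'_t+g$ for an arbitrary $g\in X^c_0\setminus\bigcup_{h\in N}X^1_h$. If no such path exists, remove $i$ from $U$. - If $\mathrm{Gain}_c<\mathrm{Gain}_1$: choose the smallest-index $i\in N\setminus U$ attaining $\mathrm{Gain}_1$ and add to $X^1_i$ an arbitrary $g\in X^c_0\setminus\bigcup_{h\in N}X^1_h$. When the loop ends, output $X^c\cup X^1$. *)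

(* Defs.v *)
From HB Require Import structures.
From mathcomp Require Import all_boot all_order all_algebra.
From mathcomp Require Import constructive_ereal reals.
From Stdlib Require Import Relation_Operators.

Set Implicit Arguments.
Unset Strict Implicit.
Unset Printing Implicit Defensive.

Import Order.TTheory GRing.Theory Num.Theory.
Local Open Scope ring_scope.

Definition sortv (n : nat) (x : n.-tuple nat) : n.-tuple nat :=
  [tuple of sort leq x].

Definition lex_gt (n : nat) (y z : n.-tuple nat) : Prop :=
  exists k : 'I_n,
    (forall j : 'I_n, (j < k)%N -> tnth y j = tnth z j) /\
    (tnth z k < tnth y k)%N.

Definition bumpv (n : nat) (x : n.-tuple nat) (i : 'I_n) (d : nat) :
  n.-tuple nat := [tuple (tnth x k + (if k == i then d else 0))%N | k < n].

(* [psi x y] reads "x is weakly preferred to y".  [total] entails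
   reflexivity. *)
Definition justice_criterion (n : nat) (psi : rel (n.-tuple nat)) : Prop :=
  total psi /\ transitive psi.

Definition strictly (T : Type) (psi : rel T) : rel T :=
  fun x y => psi x y && ~~ psi y x.

Definition indifferent (T : Type) (psi : rel T) : rel T :=
  fun x y => psi x y && psi y x.

Definition cond_C1 (n : nat) (psi : rel (n.-tuple nat)) : Prop :=
  forall x y : n.-tuple nat,
    (forall i : 'I_n, (tnth (sortv y) i <= tnth (sortv x) i)%N) ->
    psi x y /\ (indifferent psi x y <-> sortv x = sortv y).

Section GainFunctions.

Variables (R : realType) (n c : nat).

(* Only the values [phi x i d] with [d] equal to 1 or [c] are meaningful. *)
Definition gain_function : Type := n.-tuple nat -> 'I_n -> nat -> R.

Implicit Types (psi : rel (n.-tuple nat)) (phi : gain_function).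

Definition cond_G1 psi phi : Prop :=
  forall (x : n.-tuple nat) (i j : 'I_n) (d1 d2 : nat),
    d1 \in [:: 1%N; c] -> d2 \in [:: 1%N; c] ->
    phi x j d2 <= phi x i d1 ->
    psi (bumpv x i d1) (bumpv x j d2) /\
    (indifferent psi (bumpv x i d1) (bumpv x j d2) <->
       phi x i d1 = phi x j d2).

Definition cond_G2 phi : Prop :=
  forall (x y : n.-tuple nat) (i : 'I_n) (d : nat),
    d \in [:: 1%N; c] -> (tnth x i <= tnth y i)%N ->
    phi y i d <= phi x i d /\
    (tnth x i = tnth y i -> phi x i d = phi y i d).

Definition cond_G3 phi : Prop :=
  forall (x : n.-tuple nat) (i j : 'I_n) (d : nat),
    d \in [:: 1%N; c] -> (tnth x i <= tnth x j)%N ->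
    phi x j d <= phi x i d /\
    (phi x i d = phi x j d <-> tnth x i = tnth x j).

Definition cond_C2 psi phi : Prop :=
  [/\ cond_G1 psi phi, cond_G2 phi & cond_G3 phi].

End GainFunctions.

Section Valuations.

Variables (R : realType) (G : finType) (c : nat).

Definition marginal (v : {set G} -> R) (S : {set G}) (g : G) : R :=
  v (g |: S) - v S.

Definition SUB (v : {set G} -> R) : Prop :=
  [/\ forall S : {set G}, 0 <= v S,
      v set0 = 0,
      forall (S : {set G}) (g : G), g \notin S ->
        marginal v S g = 1 \/ marginal v S g = c%:R
    & forall (S T : {set G}) (g : G), S \subset T -> g \notin T ->
        marginal v T g <= marginal v S g].

End Valuations.

Section Allocations.

Variables (R : realType) (G : finType) (n c : nat).
Variable v : 'I_n -> {set G} -> R.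

(* An ordered partition of the goods is represented by the map sending each
   good to the owner of its bundle.  [Some i] is agent i and [None] is the
   dummy agent 0.  The same type represents a tuple of disjoint bundles
   indexed by the agents: there [None] marks the goods lying in none of them. *)
Definition allocation : Type := {ffun G -> option 'I_n}.

Implicit Types (X Y : allocation).

Definition bundle X (a : option 'I_n) : {set G} := [set g | X g == a].

(* The family [v] extended with the valuation of the dummy agent. *)
Definition val0 (a : option 'I_n) (S : {set G}) : R :=
  if a is Some i then v i S else (c * #|S|)%:R.

Definition beta (a : option 'I_n) (S : {set G}) : nat :=
  \max_(T : {set G} | (T \subset S) && (val0 a T == (c * #|T|)%:R)) #|T|.

(* The values of a SUB valuation are natural numbers, on which [Num.truncn]
   inverts the embedding of [nat] in [R]: see [utilityE] below. *)
Definition utility X : n.-tuple nat :=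
  [tuple Num.truncn (v i (bundle X (Some i))) | i < n].

Definition sorted_utility X : n.-tuple nat := sortv (utility X).

Definition clean X : Prop :=
  forall a : option 'I_n, beta a (bundle X a) = #|bundle X a|.

Definition decomposition X (Xc X1 : allocation) : Prop :=
  clean Xc /\
  forall i : 'I_n,
    [/\ bundle X (Some i) = bundle Xc (Some i) :|: bundle X1 (Some i),
        [disjoint bundle Xc (Some i) & bundle X1 (Some i)]
      & #|bundle Xc (Some i)| = beta (Some i) (bundle X (Some i))].

(* Meant for [X1] supported on the goods that [Xc] leaves unallocated. *)
Definition alloc_union (Xc X1 : allocation) : allocation :=
  [ffun g => if Xc g is Some i then Some i else X1 g].

Definition dominates X Y : Prop :=
  exists Xc X1 Yc Y1 : allocation,
    [/\ decomposition X Xc X1, decomposition Y Yc Y1 &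
        [\/ lex_gt (sorted_utility Xc) (sorted_utility Yc),
            sorted_utility Xc = sorted_utility Yc /\
              lex_gt (utility Xc) (utility Yc)
          | utility Xc = utility Yc /\ lex_gt (utility X) (utility Y)]].

Section Criterion.

Variable psi : rel (n.-tuple nat).

Definition psi_maximizing X : Prop :=
  forall Y, ~ strictly psi (utility Y) (utility X).

Definition dominating_psi_maximizing X : Prop :=
  psi_maximizing X /\
  forall Y, Y <> X -> psi_maximizing Y -> ~ dominates Y X.

End Criterion.

Definition exchange X : rel G := fun g g' =>
  [exists j : option 'I_n, (g \in bundle X j) &&
     (beta j (g' |: (bundle X j :\ g)) == beta j (bundle X j))].

Definition F (i : 'I_n) X : {set G} :=
  [set g | (beta (Some i) (g |: bundle X (Some i)) -
            beta (Some i) (bundle X (Some i)))%N == 1%N].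

(* A path is given by its first vertex [g] and the sequence [p] of the
   following ones. *)
Definition aug_path (i : 'I_n) X (g : G) (p : seq G) : Prop :=
  [/\ g \in F i X, path (exchange X) g p & last g p \in bundle X None].

Definition shortest_aug_path (i : 'I_n) X (g : G) (p : seq G) : Prop :=
  aug_path i X g p /\
  forall (h : G) (q : seq G), aug_path i X h q -> (size p <= size q)%N.

(* The first good of [gs] goes to agent [i], and every other good of [gs] to
   the owner in [X] of the preceding one. *)
Definition augment X (i : 'I_n) (gs : seq G) : allocation :=
  [ffun h => if h \in gs then nth (X h) (Some i :: map X gs) (index h gs)
             else X h].

Definition reassign X (g : G) (a : option 'I_n) : allocation :=
  [ffun h => if h == g then a else X h].

Variable phi : gain_function R n.

Record state : Type := State {
  st_c : allocation;
  st_1 : allocation;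
  st_U : {set 'I_n} }.

Definition init : state :=
  State [ffun=> None] [ffun=> None] [set: 'I_n].

Definition running (s : state) : bool :=
  (\sum_(h < n) #|bundle (st_1 s) (Some h)| < #|bundle (st_c s) None|)%N.

Definition output (s : state) : allocation := alloc_union (st_c s) (st_1 s).

Definition gain (s : state) (i : 'I_n) (d : nat) : R :=
  phi (utility (output s)) i d.

Definition max_gain (s : state) (A : {set 'I_n}) (d : nat) : \bar R :=
  \big[maxe/-oo%E]_(k in A) (gain s k d)%:E.

Definition Gain_c (s : state) : \bar R := max_gain s (st_U s) c.
Definition Gain_1 (s : state) : \bar R := max_gain s (~: st_U s) 1%N.

Definition selected (s : state) (A : {set 'I_n}) (d : nat) (i : 'I_n) : Prop :=
  [/\ i \in A, (gain s i d)%:E = max_gain s A d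
    & forall k : 'I_n, k \in A -> (gain s k d)%:E = max_gain s A d ->
        (i <= k)%N].

Definition free_good (s : state) (g : G) : Prop :=
  st_c s g = None /\ st_1 s g = None.

(* [refill s g' X1'] : when the good [g'] leaves the unallocated bundle of
   [st_c s], [X1'] is a possible new value of [st_1 s]. *)
Definition refill (s : state) (g' : G) (X1' : allocation) : Prop :=
  if st_1 s g' is Some j
  then exists2 g : G, free_good s g &
         X1' = reassign (reassign (st_1 s) g' None) g (Some j)
  else X1' = st_1 s.

Inductive step (s : state) : state -> Prop :=
| step_augment (i : 'I_n) (g : G) (p : seq G) (X1' : allocation) :
    running s -> (Gain_1 s <= Gain_c s)%E -> selected s (st_U s) c i ->
    shortest_aug_path i (st_c s) g p ->
    refill s (last g p) X1' ->
    step s (State (augment (st_c s) i (g :: p)) X1' (st_U s))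
| step_discard (i : 'I_n) :
    running s -> (Gain_1 s <= Gain_c s)%E -> selected s (st_U s) c i ->
    (forall (g : G) (p : seq G), ~ aug_path i (st_c s) g p) ->
    step s (State (st_c s) (st_1 s) (st_U s :\ i))
| step_one (i : 'I_n) (g : G) :
    running s -> (Gain_c s < Gain_1 s)%E -> selected s (~: st_U s) 1%N i ->
    free_good s g ->
    step s (State (st_c s) (reassign (st_1 s) g (Some i)) (st_U s)).

Definition reachable (s : state) : Prop := clos_refl_trans state step init s.

(* The algorithm leaves some choices open.  It outputs allocations satisfying
   [P] when, whatever these choices are, it never gets stuck inside the loop,
   it terminates, and the allocation it returns satisfies [P]. *)
Definition BYS_outputs (P : allocation -> Prop) : Prop :=
  [/\ forall s, reachable s -> running s -> exists s', step s s',
      ~ exists r : nat -> state, r 0%N = init /\ forall k, step (r k) (r k.+1)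
    & forall s, reachable s -> ~~ running s -> P (output s)].

Lemma SUB_nat (i : 'I_n) (S : {set G}) :
  SUB c (v i) -> v i S \is a Num.nat.
Proof.
move=> [_ v0 vm _].
have [m] := ubnP #|S|; elim: m S => // m IHm S ltSm.
have [->|[g gS]] := set_0Vmem S; first by rewrite v0.
have gS' : g \notin S :\ g by rewrite !inE eqxx.
have -> : v i S = v i (S :\ g) + marginal (v i) (S :\ g) g.
  by rewrite /marginal setD1K // addrC subrK.
rewrite rpredD //; first by apply: IHm; move: ltSm; rewrite (cardsD1 g) gS.
by case: (vm _ _ gS') => ->; [exact: rpred1 | exact: natr_nat].
Qed.

Lemma utilityE X (i : 'I_n) :
  SUB c (v i) -> (tnth (utility X) i)%:R = v i (bundle X (Some i)).
Proof. by move=> vSUB; rewrite tnth_mktuple truncnK // SUB_nat. Qed.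

End Allocations.

(* Main.v *)
(** A {1,c}-SUB valuation has the form [v S = #|S| + (c - 1) * beta S] with
    [beta] a matroid rank function, so an allocation matters only through two
    vectors: [a i] goods worth [c] and [b i] goods worth 1 to agent [i].  The
    vectors [a] of clean allocations are the integer points of a polymatroid,
    and shortest exchange paths decide whether [a i] can be raised by one.
    Fix a pair [(A, B)] that is optimal for the justice criterion, ties being
    broken by domination.  The state [(a, b)] of the algorithm stays
    componentwise below [(A, B)]: if a greedy choice left this region, swapping
    one unit of [(A, B)] for the chosen one would yield a better pair.  When no
    good remains the sums agree, hence [(a, b) = (A, B)]. *)

Require Import Defs.
From mathcomp Require Import all_boot all_order all_algebra perm.
From mathcomp Require Import constructive_ereal reals boolp.
From mathcomp Require Import zify lra.
From Stdlib Require Import Relation_Operators.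

Set Implicit Arguments.
Unset Strict Implicit.
Unset Printing Implicit Defensive.

Import Order.TTheory GRing.Theory Num.Theory.

(** * Sorted vectors and the lexicographic order *)

(** Choices use the gains of the current state, whereas the swap is judged at the optimum.
    Monotonicity links the two: the optimum lies above the state, so by (G2) no gain is larger
    there, and the gain of an agent whose utility agrees in both is unchanged. Hence an agent
    maximizing the gain in the state still does at least as well, at the optimum, as the agent whose
    unit is taken away, and (G1) turns this into a preference.

    Domination settles the ties, and each of its levels answers one kind: a larger or more even
    clean part, a smaller index among agents of [U], a smaller index among the others.

    Not every swap is feasible, since raising one coordinate of [A] may force another one down. A
    min-max argument as in matroid union, on the goods reachable in the exchange graph, supplies the
    tight sets from which that coordinate is found. Utilities are determined by the two vectors
    because an agent receives goods worth 1 only once it is saturated, and saturation is never lost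
    as the vectors grow. *)

Section SortLex.

Lemma nth_sorted_leq (s : seq nat) (p t : nat) :
  sorted leq s -> p < size s ->
  (nth 0 s p <= t) = (p < count (fun z => z <= t) s).
Proof.
elim: s p => [|x s IHs] p //= sS.
have /allP xs : all (leq x) s by apply: order_path_min sS; exact: leq_trans.
have sSs := path_sorted sS.
have [xt|tx] := leqP x t; first by case: p => [|p] //= ps; rewrite IHs.
have c0 : count (fun z => z <= t) s = 0.
  apply/eqP; rewrite -leqn0 leqNgt -has_count; apply/hasPn => z /xs.
  by rewrite -ltnNge; exact: leq_trans.
case: p => [|p] /=; first by rewrite c0 [LHS]leqNgt tx.
by rewrite ltnS => ps; rewrite IHs // c0.
Qed.

Variable n : nat.
Implicit Types x y z : n.-tuple nat.

(** Order statistics become counts of entries under a threshold, so sorted vectors can be compared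
    without following a sorting permutation. *)
Lemma tnth_sortv_leq x (p : 'I_n) t :
  (tnth (sortv x) p <= t) = (p < \sum_(k < n) (tnth x k <= t)).
Proof.
rewrite (tnth_nth 0) nth_sorted_leq ?size_tuple //; last first.
  by apply: sort_sorted; exact: leq_total.
rewrite (seq.permP (permEl (perm_sort leq x))) -sum1_count big_mkcond big_tuple /=.
by congr (_ < _); apply: eq_bigr => k _; case: leqP.
Qed.

Lemma leq_sortv x y :
  (forall k, tnth x k <= tnth y k) ->
  forall k, tnth (sortv x) k <= tnth (sortv y) k.
Proof.
move=> xy k; rewrite tnth_sortv_leq.
have := leqnn (tnth (sortv y) k); rewrite {1}tnth_sortv_leq => /leq_trans.
apply; apply: leq_sum => l _; have := xy l.
by case: (leqP (tnth y l)) => // yl xl; rewrite (leq_trans xl yl).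
Qed.

Lemma perm_sortv x y : perm_eq x y -> sortv x = sortv y.
Proof.
move=> xy; apply: val_inj => /=.
by apply/perm_sortP => //; [exact: leq_total|exact: leq_trans|exact: anti_leq].
Qed.

Lemma sum_sortv x y :
  sortv x = sortv y -> \sum_(k < n) tnth x k = \sum_(k < n) tnth y k.
Proof.
move=> xy; have {}xy : perm_eq x y.
  by rewrite -(perm_sort leq) -[sort _ x]/(val (sortv x)) xy /= perm_sort.
rewrite -(big_tuple _ _ _ predT id) -(big_tuple _ _ _ predT id) /=.
exact: perm_big.
Qed.

(** For thresholds below the old value [A] at [i] the counts agree, and at [A] itself the count of
    [y] is smaller by one. Position [N y A] is therefore the first at which the sorted vectors
    differ. *)
Lemma sortv_lex_gt x y (i : 'I_n) :
  tnth x i < tnth y i ->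
  (forall k, k != i -> tnth y k = tnth x k \/
     (tnth x i < tnth x k /\ tnth x i < tnth y k)) ->
  lex_gt (sortv y) (sortv x).
Proof.
move=> xyi xyk; set A := tnth x i.
pose N z t := \sum_(k < n) (tnth z k <= t).
have NE t : t < A -> N y t = N x t.
  move=> tA; apply: eq_bigr => k _; have [->|/xyk] := eqVneq k i.
    by rewrite (ltn_geF tA) (ltn_geF (ltn_trans tA xyi)).
  case=> [-> //|[xk yk]].
  by rewrite (ltn_geF (ltn_trans tA xk)) (ltn_geF (ltn_trans tA yk)).
have NA : N x A = (N y A).+1.
  rewrite /N (bigD1 i) //= leqnn [in RHS](bigD1 i) //= (ltn_geF xyi) add0n add1n.
  congr _.+1; apply: eq_bigr => k /xyk [-> //|[xk yk]].
  by rewrite (ltn_geF xk) (ltn_geF yk).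
have pn : N y A < n.
  rewrite -NA /N -[leqRHS]card_ord -sum1_card.
  by apply: leq_sum => k _; exact: leq_b1.
exists (Ordinal pn); split=> [j /= jp|]; last first.
  have := ltnn (N y A); rewrite -{2}[N y A]/(val (Ordinal pn)).
  move: (tnth_sortv_leq y (Ordinal pn) A); rewrite /= ltnn => /negbT.
  rewrite -ltnNge => yA _; apply: leq_trans yA.
  by rewrite ltnS tnth_sortv_leq -/(N x A) NA.
have yA : tnth (sortv y) j <= A by rewrite tnth_sortv_leq.
have xA : tnth (sortv x) j <= A by rewrite tnth_sortv_leq -/(N _ _) NA ltnW.
have E t : t < A -> (tnth (sortv y) j <= t) = (tnth (sortv x) j <= t).
  by move=> tA; rewrite !tnth_sortv_leq -!/(N _ _) NE.
apply/eqP; rewrite eqn_leq; apply/andP; split.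
  have [Ax|xlt] := leqP A (tnth (sortv x) j); first exact: leq_trans yA Ax.
  by rewrite E.
have [Ay|ylt] := leqP A (tnth (sortv y) j); first exact: leq_trans xA Ay.
by rewrite -E.
Qed.

Lemma lex_gt_trans x y z : lex_gt x y -> lex_gt y z -> lex_gt x z.
Proof.
move=> [k [xyk kxy]] [l [yzl lyz]].
have [kl|lk|/val_inj kl] := ltngtP k l.
- exists k; split=> [j jk|]; last by rewrite -yzl.
  by rewrite xyk // yzl // (ltn_trans jk).
- exists l; split=> [j jl|]; last by rewrite xyk.
  by rewrite xyk ?yzl // (ltn_trans jl).
- rewrite -{}kl in yzl lyz; exists k; split=> [j jk|].
    by rewrite xyk ?yzl.
  exact: ltn_trans kxy.
Qed.

Lemma lex_gt_irr x : ~ lex_gt x x.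
Proof. by move=> [k [_]]; rewrite ltnn. Qed.

Lemma lex_gt_first x y (i : 'I_n) :
  tnth x i < tnth y i -> (forall k : 'I_n, k < i -> tnth y k = tnth x k) ->
  lex_gt y x.
Proof. by move=> xyi xyk; exists i. Qed.

End SortLex.

Lemma exists_maximal (T : finType) (P : T -> Prop) (lt : T -> T -> Prop) x0 :
  (forall x, ~ lt x x) -> (forall x y z, lt x y -> lt y z -> lt x z) ->
  P x0 -> exists x, P x /\ forall y, P y -> ~ lt x y.
Proof.
move=> irr tr.
pose up x := [set y | `[< P y /\ lt x y >]].
have [k] := ubnP #|up x0|; elim: k x0 => // k IHk x0 ltk Px0.
have [[y [Py xy]]|H] := pselect (exists y, P y /\ lt x0 y); last first.
  by exists x0; split=> // y Py xy; apply: H; exists y.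
apply: (IHk y) => //; rewrite -ltnS (leq_trans _ ltk) // ltnS.
apply: proper_card; apply/properP; split.
  apply/subsetP => z; rewrite !inE => /asboolP[Pz yz].
  by apply/asboolP; split=> //; exact: tr yz.
exists y; rewrite !inE; first exact/asboolP.
by apply/asboolP => -[_ /irr].
Qed.

(** * The greedy exchange argument on vectors *)

Section Update.

Variable n : nat.
Implicit Types (f g : 'I_n -> nat) (i j : 'I_n).

Definition upd f i p : 'I_n -> nat := fun k => if k == i then p else f k.

Lemma upd_neq f i p k : k != i -> upd f i p k = f k.
Proof. by rewrite /upd => /negbTE->. Qed.

(** The old value is added on the left, so that no truncated subtraction appears and [lia] can chain
    several updates. *)
Lemma sum_upd f i p : \sum_k upd f i p k + f i = \sum_k f k + p.
Proof.
rewrite (bigD1 i) //= {1}/upd eqxx [in RHS](bigD1 i) //=.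
under eq_bigr => k /negbTE ki do rewrite /upd ki.
by lia.
Qed.

Lemma sum_updS f i : \sum_k upd f i (f i).+1 k = (\sum_k f k).+1.
Proof. by have := sum_upd f i (f i).+1; lia. Qed.

Lemma exists_ltn f g : \sum_k f k < \sum_k g k -> exists k, f k < g k.
Proof.
move=> fg; apply/existsP; apply: contraLR fg => /existsPn fg.
by rewrite -leqNgt; apply: leq_sum => k _; rewrite leqNgt fg.
Qed.

Definition vec f : n.-tuple nat := [tuple f k | k < n].

Lemma tnth_vec f k : tnth (vec f) k = f k.
Proof. exact: tnth_mktuple. Qed.

Lemma vec_swap f i j : perm_eq (vec (upd (upd f i (f j)) j (f i))) (vec f).
Proof.
apply/tuple_permP; exists (tperm i j); apply: congr1.
apply: eq_from_tnth => k; rewrite !tnth_mktuple /upd.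
by case: tpermP => [->|->|/eqP/negbTE-> /eqP/negbTE->]; rewrite ?eqxx //; case: eqP => [->|].
Qed.

Lemma vec_swap_upd f i j : perm_eq (vec (upd (upd f i (f j)) j (f i)))
  (vec (upd (upd f i (f i)) j (f j))).
Proof.
rewrite (_ : vec (upd (upd f i (f i)) j (f j)) = vec f) ?vec_swap //.
apply: eq_from_tnth => k; rewrite !tnth_vec /upd.
by case: eqP => [->|_] //; case: eqP => [->|].
Qed.

End Update.

Section Greedy.

Variables (R : realType) (n c m : nat).
Variables (psi : rel (n.-tuple nat)) (phi : gain_function R n).
Hypothesis c2 : 2 <= c.
Hypothesis psiJ : justice_criterion psi.
Hypothesis psiC1 : cond_C1 psi.
Hypothesis psiC2 : cond_C2 c psi phi.

Implicit Types (x y z : n.-tuple nat) (i j k : 'I_n) (a b A B : 'I_n -> nat).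

Let psi_total : total psi. Proof. exact: psiJ.1. Qed.
Let psi_trans : transitive psi. Proof. exact: psiJ.2. Qed.
Let G1 : cond_G1 c psi phi. Proof. by case: psiC2. Qed.
Let G2 : cond_G2 c phi. Proof. by case: psiC2. Qed.
Let G3 : cond_G3 c phi. Proof. by case: psiC2. Qed.
Let one_in : 1 \in [:: 1; c]. Proof. by rewrite inE. Qed.
Let c_in : c \in [:: 1; c]. Proof. by rewrite !inE eqxx orbT. Qed.

Lemma strictly_trans x y z :
  strictly psi x y -> strictly psi y z -> strictly psi x z.
Proof.
move=> /andP[xy _] /andP[yz zy]; apply/andP; split; first exact: psi_trans yz.
by apply: contra zy => zx; exact: psi_trans xy.
Qed.

(** Indifference would force equal sorted vectors by (C1), hence equal sums, against the increase at
    [i]. *)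
Lemma strictly_pareto x y i :
  (forall k, tnth x k <= tnth y k) -> tnth x i < tnth y i -> strictly psi y x.
Proof.
move=> xy xyi; have [yx ind] := psiC1 (leq_sortv xy).
rewrite /strictly yx /=; apply/negP => xy'.
have /sum_sortv : sortv y = sortv x by apply/ind; rewrite /indifferent yx.
rewrite (bigD1 i) //= [in RHS](bigD1 i) //=.
have : \sum_(k < n | k != i) tnth x k <= \sum_(k < n | k != i) tnth y k.
  exact: leq_sum.
by move=> le /eqP; rewrite gtn_eqF // -addSn leq_add.
Qed.

Lemma psi_sortv x y : sortv x = sortv y -> psi x y.
Proof. by move=> xy; have [|//] := psiC1 (x := x) (y := y); rewrite xy. Qed.

Lemma psi_perm x y : perm_eq x y -> psi x y.
Proof. by move/perm_sortv/psi_sortv. Qed.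

Lemma psi_bumpv x i j d1 d2 :
  d1 \in [:: 1; c] -> d2 \in [:: 1; c] -> (phi x j d2 < phi x i d1)%R ->
  strictly psi (bumpv x i d1) (bumpv x j d2).
Proof.
move=> d1in d2in lt; have [le ind] := G1 d1in d2in (ltW lt).
rewrite /strictly le /=; apply/negP => ge; move: lt.
by rewrite (ind.1 _) ?ltxx // /indifferent le.
Qed.

Lemma gain_1_lt_c x i : (phi x i 1%N < phi x i c)%R.
Proof.
rewrite ltNge; apply/negP => /(G1 one_in c_in)[le _].
have /andP[_ /negP] : strictly psi (bumpv x i c) (bumpv x i 1).
  apply: (@strictly_pareto _ _ i) => [k|]; rewrite !tnth_mktuple ?eqxx; last by lia.
  by case: eqP; lia.
by apply.
Qed.

(** Both vectors are [x] plus one unit, given to [i] or to [j]. By (G3) the poorer [i] has the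
    strictly larger gain, so inequality aversion comes from the gain function. *)
Lemma unit_transfer (f : 'I_n -> nat) i j p q : i != j -> p < q ->
  strictly psi (vec (upd (upd f i p.+1) j q)) (vec (upd (upd f i p) j q.+1)).
Proof.
move=> ij pq; pose x := vec (upd (upd f i p) j q).
have xi : tnth x i = p by rewrite tnth_vec /upd (negbTE ij) eqxx.
have xj : tnth x j = q by rewrite tnth_vec /upd eqxx.
have -> : vec (upd (upd f i p.+1) j q) = bumpv x i 1.
  apply: eq_from_tnth => k; rewrite !tnth_mktuple /upd.
  case: (eqVneq k i) => [->|_]; first by rewrite (negbTE ij) addn1.
  by rewrite addn0.
have -> : vec (upd (upd f i p) j q.+1) = bumpv x j 1.
  apply: eq_from_tnth => k; rewrite !tnth_mktuple /upd.
  by case: (eqVneq k j) => _; rewrite ?addn1 ?addn0.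
apply: psi_bumpv => //; rewrite lt_neqAle.
have [|le [eq _]] := @G3 x i j 1 one_in; first by rewrite xi xj ltnW.
by rewrite le andbT; apply/eqP => /esym/eq; rewrite xi xj; lia.
Qed.

(** The transfer is a chain of unit transfers, each from richer to poorer while [p' <= q']. The
    other order reduces to this one because (C1) makes [psi] blind to permutations. *)
Lemma pigou_dalton (f : 'I_n -> nat) i j p q p' q' :
  i != j -> p + q = p' + q' -> p < p' -> p < q' ->
  strictly psi (vec (upd (upd f i p') j q')) (vec (upd (upd f i p) j q)).
Proof.
move=> ij.
wlog le : p' q' / p' <= q' => [H|].
  have [/H//|/ltnW le] := leqP p' q' => s pp' pq'.
  have /andP[h1 h2] : strictly psi (vec (upd (upd f i q') j p'))
                        (vec (upd (upd f i p) j q)) by apply: H => //; lia.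
  have sw : sortv (vec (upd (upd f i p') j q')) =
            sortv (vec (upd (upd f i q') j p')).
    rewrite -(perm_sortv (vec_swap (upd (upd f i q') j p') i j)); congr sortv.
    apply: eq_from_tnth => k; rewrite !tnth_vec /upd !eqxx (negbTE ij).
    by case: eqP => // _; case: eqP.
  apply/andP; split; first by apply: psi_trans h1; exact: psi_sortv.
  apply: contra h2 => h2; apply: (psi_trans h2); exact: psi_sortv.
elim: p' q' le => // p' IHp q' le s; rewrite ltnS leq_eqVlt => pp' pq'.
case/predU1P: pp' => [pE|pp'].
  have -> : q = q'.+1 by lia.
  by rewrite -pE; apply: unit_transfer.
apply: (@strictly_trans _ (vec (upd (upd f i p') j q'.+1))).
  by apply: unit_transfer.
by apply: IHp; lia.
Qed.

(* The utilities when agent [k] holds [A k] goods worth [c] and [B k] goods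
   worth 1. *)
Definition uv A B := vec (fun k => c * A k + B k).

(** The counterpart of [dominates] for pairs: [uv A (fun=> 0)] is the utility vector of a clean
    allocation with bundle sizes [A]. *)
Definition dom A' B' A B : Prop :=
  [\/ lex_gt (sortv (uv A' (fun=> 0))) (sortv (uv A (fun=> 0))),
      sortv (uv A' (fun=> 0)) = sortv (uv A (fun=> 0)) /\
        lex_gt (uv A' (fun=> 0)) (uv A (fun=> 0))
    | uv A' (fun=> 0) = uv A (fun=> 0) /\ lex_gt (uv A' B') (uv A B)].

(** Domination refines [psi] on its ties, so a maximal pair settles both halves of
    [dominating_psi_maximizing] at once. *)
Definition better A' B' A B : Prop :=
  psi (uv A' B') (uv A B) /\ (psi (uv A B) (uv A' B') -> dom A' B' A B).

Lemma dom_trans A1 B1 A2 B2 A3 B3 :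
  dom A1 B1 A2 B2 -> dom A2 B2 A3 B3 -> dom A1 B1 A3 B3.
Proof.
case=> [h|[e h]|[e h]] [h'|[e' h']|[e' h']].
- by constructor 1; exact: lex_gt_trans h'.
- by constructor 1; rewrite -e'.
- by constructor 1; rewrite -e'.
- by constructor 1; rewrite e.
- by constructor 2; rewrite e; split=> //; exact: lex_gt_trans h'.
- by constructor 2; rewrite -e'; split.
- by constructor 1; rewrite e.
- by constructor 2; rewrite e.
- by constructor 3; rewrite e; split=> //; exact: lex_gt_trans h'.
Qed.

Lemma better_trans A1 B1 A2 B2 A3 B3 :
  better A1 B1 A2 B2 -> better A2 B2 A3 B3 -> better A1 B1 A3 B3.
Proof.
move=> [h12 d12] [h23 d23]; split; first exact: psi_trans h23.
move=> h31; apply: (@dom_trans _ _ A2 B2).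
  by apply: d12; exact: psi_trans h31.
by apply: d23; exact: psi_trans h12.
Qed.

Lemma better_irr A B : ~ better A B A B.
Proof.
move=> [h /(_ h)].
by case=> [/lex_gt_irr|[_ /lex_gt_irr]|[_ /lex_gt_irr]].
Qed.

Lemma better_strict A' B' A B :
  strictly psi (uv A' B') (uv A B) -> better A' B' A B.
Proof. by move=> /andP[h /negP h']; split. Qed.

Variable P : ('I_n -> nat) -> Prop.
Hypothesis P_down : forall a A, (forall k, a k <= A k) -> P A -> P a.
(* [T] is the largest tight set of the polymatroid [P] at [a]. *)
Hypothesis P_sat : forall a, P a -> exists T : {set 'I_n},
  (forall i, i \notin T -> P (upd a i (a i).+1)) /\
  (forall A, P A -> \sum_(i in T) A i <= \sum_(i in T) a i).

Lemma P_maximal_below a A : P a -> (forall k, a k <= A k) ->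
  exists w, [/\ P w, forall k, a k <= w k <= A k
    & forall k, w k < A k -> ~ P (upd w k (w k).+1)].
Proof.
have [s] := ubnP (\sum_k A k - \sum_k a k); elim: s a => // s IHs a lts Pa aA.
have [[k [kA Pk]]|H] := pselect (exists k, a k < A k /\ P (upd a k (a k).+1)).
  have uA l : upd a k (a k).+1 l <= A l by rewrite /upd; case: eqP => // ->.
  have lt : \sum_k A k - \sum_l upd a k (a k).+1 l < s.
    have E := sum_upd a k (a k).+1.
    have le : \sum_l upd a k (a k).+1 l <= \sum_l A l by exact: leq_sum.
    by lia.
  have [w [Pw wb wm]] := IHs _ lt Pk uA.
  exists w; split=> // l; have /andP[ul ->] := wb l; rewrite andbT.
  by apply: leq_trans ul; rewrite /upd; case: eqP => // ->.
exists a; split=> // [k|k kA Pk]; first by rewrite leqnn aA.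
by apply: H; exists k.
Qed.

(** Take [w] maximal in [P] between [a] raised at [i] and [z]. Off the tight set of [w] it reaches
    [z], and on the tight set its sum bounds that of [A], so [w] misses at most one unit of [z]. As
    [z] is not in [P], exactly one is missing, and not at [i], where [w] already equals [z]. *)
Lemma P_exchange a A i : P A -> (forall k, a k <= A k) -> A i = a i ->
  P (upd a i (a i).+1) -> ~ P (upd A i (A i).+1) ->
  exists j, [/\ j != i, a j < A j & P (upd (upd A i (A i).+1) j (A j).-1)].
Proof.
move=> PA aA Ai Pai nPAi; set z := upd A i (A i).+1 in nPAi *.
have az k : upd a i (a i).+1 k <= z k by rewrite /z /upd; case: eqP => // _; rewrite Ai.
have [w [Pw wb wm]] := P_maximal_below Pai az.
have [T [wT AT]] := P_sat Pw.
have Aw : \sum_k A k <= \sum_k w k.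
  rewrite [leqLHS](bigID (mem T)) [leqRHS](bigID (mem T)) /=.
  apply: leq_add; first exact: AT.
  apply: leq_sum => k kT; rewrite leqNgt; apply/negP => wA.
  apply: (wm k); last exact: wT.
  by apply: leq_trans wA _; rewrite /z /upd; case: eqP => // ->.
have [j wj] : exists j, w j < z j.
  apply: contrapT => H; apply: nPAi; apply: P_down Pw => k.
  by rewrite leqNgt; apply/negP => wk; apply: H; exists k.
have ji : j != i.
  apply: contraTneq wj => ->; have /andP[+ _] := wb i.
  by rewrite -leqNgt /z /upd !eqxx Ai.
have zj : z j = A j by rewrite /z /upd (negbTE ji).
have awj : a j <= w j by have /andP[+ _] := wb j; rewrite /upd (negbTE ji).
exists j; split=> //; first by rewrite (leq_ltn_trans awj) // -zj.
apply: P_down Pw => k; rewrite leqNgt; apply/negP => wk.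
have : \sum_k w k < \sum_k upd z j (A j).-1 k.
  rewrite (bigD1 k) //= [ltnRHS](bigD1 k) //= -addSn leq_add //.
  apply: leq_sum => l lk; have /andP[_ wl] := wb l.
  by move: wj wl; rewrite /upd; case: eqP => // ->; rewrite zj; lia.
have := sum_upd z j (A j).-1; have := sum_upd A i (A i).+1.
rewrite -/z zj; move: wj; rewrite zj; lia.
Qed.

Definition feasible A B := P A /\ \sum_k A k + \sum_k B k <= m.

Definition optimal A B :=
  feasible A B /\ forall A' B', feasible A' B' -> ~ better A' B' A B.

Lemma exists_optimal : P (fun=> 0) -> exists A B, optimal A B.
Proof.
move=> P0.
(* Entries of a feasible pair are at most [m], so all such pairs embed in this finite type. *)
pose T := ({ffun 'I_n -> 'I_m.+1} * {ffun 'I_n -> 'I_m.+1})%type.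
pose fn (f : {ffun 'I_n -> 'I_m.+1}) k := nat_of_ord (f k).
have [] := @exists_maximal T (fun t => feasible (fn t.1) (fn t.2))
  (fun s t => better (fn t.1) (fn t.2) (fn s.1) (fn s.2))
  ([ffun=> ord0], [ffun=> ord0]).
- by move=> t; exact: better_irr.
- by move=> s t u h h'; exact: better_trans h.
- split; first by apply: P_down P0 => k; rewrite /fn /= ffunE.
  by rewrite !big1 // => k _; rewrite /fn /= ffunE.
move=> [fA fB] [/= fAB H]; exists (fn fA), (fn fB); split=> // A B AB.
have bound (f : 'I_n -> nat) : \sum_k f k <= m ->
    fn [ffun k => inord (f k)] = f.
  move=> fm; apply/funext => k; rewrite /fn ffunE inordK // ltnS.
  by apply: leq_trans fm; rewrite (bigD1 k) //= leq_addr.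
have [_ ABm] := AB.
rewrite -(bound A) ?(leq_trans _ ABm) ?leq_addr //.
rewrite -(bound B) ?(leq_trans _ ABm) ?leq_addl //.
apply: (H ([ffun k => inord (A k)], [ffun k => inord (B k)])).
by rewrite /= !bound ?(leq_trans _ ABm) ?leq_addr ?leq_addl.
Qed.

Lemma uv_pareto a b a' b' i :
  (forall k, c * a k + b k <= c * a' k + b' k) ->
  c * a i + b i < c * a' i + b' i -> better a' b' a b.
Proof.
move=> le lt; apply: better_strict.
by apply: (@strictly_pareto _ _ i) => [k|]; rewrite !tnth_vec.
Qed.

(** A leftover good could still be handed out as one worth 1; [n0] provides the receiver. *)
Lemma optimal_full A B : 0 < n -> optimal A B -> \sum_k A k + \sum_k B k = m.
Proof.
move=> n0 [[PA le] opt]; apply/eqP; rewrite eqn_leq le leqNgt.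
apply/negP => lt; pose i := Ordinal n0.
apply: (opt A (upd B i (B i).+1)).
  by split=> //; have := sum_upd B i (B i).+1; lia.
apply: (@uv_pareto _ _ _ _ i) => [k|]; last by rewrite /upd eqxx; lia.
by rewrite /upd; case: eqP => [->|_]; lia.
Qed.

(** * One greedy step compared with a fixed optimal pair *)

Section Exchange.

Variables (A B a b : 'I_n -> nat) (U : {set 'I_n}).
Hypothesis n0 : 0 < n.
Hypothesis opt : optimal A B.
Hypothesis aA : forall k, a k <= A k.
Hypothesis bB : forall k, b k <= B k.
Hypothesis bU : forall k, k \in U -> b k = 0.
Hypothesis notU : forall k, k \notin U -> ~ P (upd a k (a k).+1).
Hypothesis notfull : \sum_k a k + \sum_k b k < m.

Let u := uv a b.

(** Raising [a j] by one stays below [A], hence in [P], whereas agents outside [U] are saturated. *)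
Lemma in_active j : a j < A j -> j \in U.
Proof.
move=> ajA; apply/negPn/negP => /notU; apply; apply: P_down opt.1.1 => k.
by rewrite /upd; case: eqP => [->|].
Qed.

Lemma exists_gap : exists j, a j < A j \/ b j < B j.
Proof.
have [] := @exists_ltn n (fun k => a k + b k) (fun k => A k + B k).
  by rewrite !big_split /= (optimal_full n0 opt).
move=> j lt; exists j; have := aA j; have := bB j; lia.
Qed.

(* Exchanging a good from [j] to [i] could lower welfare when [i] holds
   1-valued goods, so [minn c (B i)] of these move from [i] to [j] in return;
   the net effect is then a Pigou-Dalton transfer or a swap of utilities. *)
Lemma exchange_c i j : i \in U -> j \in U -> i != j -> A i = a i -> a j < A j ->
  (phi u j c <= phi u i c)%R -> (phi u j c = phi u i c -> (i <= j)%N) ->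
  ~ P (upd (upd A i (A i).+1) j (A j).-1).
Proof.
move=> iU jU ij Ai aj gain tie PA'.
have ji : j != i by rewrite eq_sym.
have uE k : k \in U -> tnth u k = c * a k by move=> kU; rewrite tnth_vec bU ?addn0.
(* Without goods worth 1, utilities in [U] are [c] times the entries of [a]; a smaller [a j] would
   give [j] a strictly larger gain by (G3). *)
have aij : a i <= a j.
  rewrite leqNgt; apply/negP => lt.
  have [|le ind] := @G3 u j i c c_in.
    by rewrite !uE // leq_mul2l (ltnW lt) orbT.
  have /eqP : tnth u j = tnth u i by apply/ind/eqP; rewrite eq_le gain le.
  by rewrite !uE // eqn_pmul2l; lia.
have tie' : a i = a j -> i < j.
  move=> e; rewrite ltn_neqAle (inj_eq val_inj) ij /=.
  have uij : tnth u i = tnth u j by rewrite !uE ?e.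
  by apply: tie; apply/esym/(G3 c_in _).2; rewrite ?uij.
case E : (A j) aj PA' => [//|g] ag /= PA'; rewrite ltnS in ag.
pose q := minn c (B i); pose A' := upd (upd A i (A i).+1) j g.
pose B' := upd (upd B i (B i - q)) j (B j + q).
have feas : feasible A' B'.
  split=> //; have [_ le] := opt.1.
  have := sum_upd A i (A i).+1; have := sum_upd (upd A i (A i).+1) j g.
  have := sum_upd B i (B i - q); have := sum_upd (upd B i (B i - q)) j (B j + q).
  rewrite !(upd_neq _ _ ji) -/A' -/B' E; have : q <= B i by rewrite geq_minr.
  by lia.
(* If [A i < g], the clean part becomes more even and its sorted vector improves. Otherwise
   [g = A i], the clean parts of [i] and [j] trade places, and the smaller index of [i] decides. *)
have domA : dom A' B' A B.
  have [lt|ge] := ltnP (A i) g.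
    constructor 1; apply: (@sortv_lex_gt _ _ _ i) => [|k ki].
      by rewrite !tnth_vec /A' /upd eqxx (negbTE ij) !addn0 ltn_pmul2l; lia.
    rewrite !tnth_vec /A' /upd (negbTE ki) !addn0 !ltn_pmul2l; try lia.
    by case: eqP => [->|_]; [right; rewrite E; lia|left].
  have gE : g = A i by apply/eqP; rewrite eqn_leq ge Ai (leq_trans aij).
  have lt : i < j by apply: tie'; lia.
  constructor 2; split.
    rewrite -(perm_sortv (vec_swap (fun k => c * A k + 0) i j)); congr sortv.
    apply: eq_from_tnth => k; rewrite !tnth_vec /A' /upd E gE.
    by case: (eqVneq k j) => _ //; case: (eqVneq k i).
  apply: (@lex_gt_first _ _ _ i) => [|k ki]; rewrite !tnth_vec /A' /upd.
    by rewrite (negbTE ij) eqxx; lia.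
  by rewrite -!val_eqE /= !ltn_eqF // (ltn_trans ki).
have [_ /(_ _ _ feas)] := opt; apply.
suff H : strictly psi (uv A' B') (uv A B) \/ psi (uv A' B') (uv A B).
  by case: H => [/better_strict //|h]; split.
pose f k := c * A k + B k.
have eA : uv A B = vec (upd (upd f i (f i)) j (f j)).
  apply: eq_from_tnth => k; rewrite !tnth_vec /upd.
  by case: (eqVneq k j) => [->|_] //; case: (eqVneq k i) => [->|_].
have eA' : uv A' B' = vec (upd (upd f i (c * (A i).+1 + (B i - q))) j (c * g + (B j + q))).
  apply: eq_from_tnth => k; rewrite !tnth_vec /upd /A' /B' /upd.
  by case: (eqVneq k j) => _ //; case: (eqVneq k i).
have cg : c * A i <= c * g by rewrite leq_mul2l Ai (leq_trans aij) ?orbT.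
have fj : f j = c * g + c + B j by rewrite /f E mulnS; lia.
(* If [i] can return [c] goods worth 1, no utility changes. Otherwise it returns all [B i] of them,
   and both new utilities exceed the old one of [i], except when [c * A i = c * g + B j], where the
   two utilities are exchanged. *)
have [cB|Bc] := leqP c (B i).
  right; suff -> : uv A' B' = uv A B by case/orP: (psi_total (uv A B) (uv A B)).
  have qE : q = c by rewrite /q; lia.
  rewrite eA eA'; congr (vec (upd (upd _ _ _) _ _)); rewrite ?fj /f qE ?mulnS; lia.
have qE : q = B i by rewrite /q; lia.
have [e|ne] := eqVneq (c * A i) (c * g + B j).
  right; apply: psi_perm; rewrite eA eA'.
  have -> : c * (A i).+1 + (B i - q) = f j by rewrite fj mulnS qE; lia.
  have -> : c * g + (B j + q) = f i by rewrite qE /f; lia.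
  exact: vec_swap_upd.
by left; rewrite eA eA'; apply: pigou_dalton => //; rewrite ?fj /f qE ?mulnS; lia.
Qed.

Lemma gain_le x k d : d \in [:: 1; c] -> tnth u k <= tnth x k ->
  (phi x k d <= phi u k d)%R.
Proof. by move=> din le; exact: (G2 din le).1. Qed.

Lemma gain_eq x k d : d \in [:: 1; c] -> tnth u k = tnth x k ->
  phi x k d = phi u k d.
Proof. by move=> din e; apply/esym/(G2 din _).2; rewrite ?e. Qed.

Lemma psi_move x y z i j d1 d2 : d1 \in [:: 1; c] -> d2 \in [:: 1; c] ->
  y = bumpv x i d1 -> z = bumpv x j d2 -> (phi x j d2 <= phi x i d1)%R ->
  psi y z.
Proof. by move=> d1in d2in -> -> /(G1 d1in d2in)[]. Qed.

(** If [A i = a i], the optimum can be improved: by an exchange when [A] has no room for [i], by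
    upgrading a good of [i] when [B i > 0], and else by taking a unit from an agent where the
    optimum exceeds the state. *)
Lemma greedy_c i : i \in U -> P (upd a i (a i).+1) ->
  (forall k, k \in U -> (phi u k c <= phi u i c)%R) ->
  (forall k, k \in U -> phi u k c = phi u i c -> (i <= k)%N) ->
  (forall k, k \notin U -> (phi u k 1%N <= phi u i c)%R) ->
  a i < A i.
Proof.
move=> iU Pi gc tie g1; rewrite ltnNge; apply/negP => Ai.
have {}Ai : A i = a i by apply/eqP; rewrite eqn_leq Ai aA.
have exch j : j != i -> a j < A j -> ~ P (upd (upd A i (A i).+1) j (A j).-1).
  move=> ji aj; have jU := in_active aj.
  by apply: exchange_c => //; [rewrite eq_sym|exact: gc|exact: tie].
have [PA|nPA] := pselect (P (upd A i (A i).+1)); last first.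
  by have [j [ji aj /exch]] := P_exchange opt.1.1 aA Ai Pi nPA; apply.
have [Bi|] := posnP (B i); last first.
  move=> Bi; apply: (opt.2 (upd A i (A i).+1) (upd B i (B i).-1)).
    split=> //; have [_ le] := opt.1.
    have := sum_upd A i (A i).+1; have := sum_upd B i (B i).-1; lia.
  have lt : c * A i + B i < c * (A i).+1 + (B i).-1 by rewrite mulnS; lia.
  apply: (@uv_pareto _ _ _ _ i) => [k|]; rewrite /upd ?eqxx //.
  by case: (eqVneq k i) => [->|//]; exact: ltnW.
have [j] := exists_gap; have [ajA _|ajA [|bjB]] := ltnP (a j) (A j).
- have ji : j != i by apply: contraTneq ajA => ->; rewrite Ai ltnn.
  apply: (exch j) => //; apply: P_down PA => k.
  by rewrite /upd; case: eqP => // ->; rewrite (negbTE ji) leq_pred.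
- by [].
have ji : j != i by apply: contraTneq bjB => ->; rewrite Bi.
(* Common base of the optimum, which adds 1 to [j], and of its rival, which adds [c] to [i]; (G1)
   compares them through the gains at [x]. *)
pose x := uv A (upd B j (B j).-1).
have ux k : tnth u k <= tnth x k.
  rewrite !tnth_vec /upd leq_add ?leq_mul2l ?aA ?orbT //.
  by case: eqP => [->|_]; [rewrite -ltnS prednK ?(leq_ltn_trans _ bjB)|].
have xi : tnth u i = tnth x i.
  by rewrite !tnth_vec bU // upd_neq 1?eq_sym // Bi Ai.
have yE : uv (upd A i (A i).+1) (upd B j (B j).-1) = bumpv x i c.
  apply: eq_from_tnth => k; rewrite !tnth_mktuple /upd.
  by case: (eqVneq k i) => [->|_]; rewrite ?mulnS; lia.
have zE : uv A B = bumpv x j 1.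
  apply: eq_from_tnth => k; rewrite !tnth_mktuple /upd.
  by case: (eqVneq k j) => [->|_]; lia.
have gj : (phi x j 1%N <= phi x i c)%R.
  rewrite (gain_eq c_in xi); have [jU|jU] := boolP (j \in U).
    apply: (le_trans (ltW (gain_1_lt_c _ _))).
    by apply: le_trans (gc _ jU); exact: gain_le.
  by apply: le_trans (g1 _ jU); exact: gain_le.
apply: (opt.2 (upd A i (A i).+1) (upd B j (B j).-1)).
  split=> //; have [_ le] := opt.1.
  have := sum_upd A i (A i).+1; have := sum_upd B j (B j).-1; lia.
split=> [|_]; first exact: psi_move yE zE gj.
(* In case of a tie the rival wins by domination, as its clean part only grows. *)
constructor 1; apply: (@sortv_lex_gt _ _ _ i) => [|k ki].
  by rewrite !tnth_vec /upd eqxx mulnS; lia.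
by left; rewrite !tnth_vec upd_neq.
Qed.

(** If [B i = b i], a unit in which the optimum exceeds the state is moved to [i]. Taken from an
    agent of [U], this is a strict improvement since gains there are strictly smaller; otherwise a
    tie is possible and the smaller index decides. *)
Lemma greedy_1 i : i \notin U ->
  (forall k, k \notin U -> (phi u k 1%N <= phi u i 1%N)%R) ->
  (forall k, k \notin U -> phi u k 1%N = phi u i 1%N -> (i <= k)%N) ->
  (forall k, k \in U -> (phi u k c < phi u i 1%N)%R) ->
  b i < B i.
Proof.
move=> iU g1 tie gc; rewrite ltnNge; apply/negP => Bi.
have {}Bi : B i = b i by apply/eqP; rewrite eqn_leq Bi bB.
have Ai : A i = a i.
  apply/eqP; rewrite eqn_leq aA andbT leqNgt.
  by apply/negP => /in_active; exact/negP.
have [j] := exists_gap; have [ajA _|ajA [|bjB]] := ltnP (a j) (A j).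
- have jU := in_active ajA.
  have ji : j != i by apply: contraTneq jU => ->.
  pose x := uv (upd A j (A j).-1) B.
  have xj : tnth u j <= tnth x j.
    by rewrite !tnth_vec /upd eqxx leq_add ?leq_mul2l //; lia.
  have xi : tnth u i = tnth x i by rewrite !tnth_vec upd_neq 1?eq_sym // Bi Ai.
  apply: (opt.2 (upd A j (A j).-1) (upd B i (B i).+1)).
    split.
      by apply: P_down opt.1.1 => k; rewrite /upd; case: eqP => // ->; lia.
    have [_ le] := opt.1.
    have := sum_upd A j (A j).-1; have := sum_upd B i (B i).+1; lia.
  apply: better_strict.
  have -> : uv (upd A j (A j).-1) (upd B i (B i).+1) = bumpv x i 1.
    apply: eq_from_tnth => k; rewrite !tnth_mktuple /upd.
    by case: (eqVneq k i) => [->|_]; lia.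
  have -> : uv A B = bumpv x j c.
    apply: eq_from_tnth => k; rewrite !tnth_mktuple /upd.
    case: (eqVneq k j) => [->|_]; last by lia.
    by case: (A j) ajA => // p _; rewrite mulnS /=; lia.
  apply: psi_bumpv => //; rewrite (gain_eq one_in xi).
  by apply: le_lt_trans (gc _ jU); exact: gain_le.
- by [].
have ji : j != i by apply: contraTneq bjB => ->; rewrite Bi ltnn.
pose x := uv A (upd B j (B j).-1).
have ux k : tnth u k <= tnth x k.
  rewrite !tnth_vec /upd leq_add ?leq_mul2l ?aA ?orbT //.
  by case: eqP => [->|_]; [rewrite -ltnS prednK ?(leq_ltn_trans _ bjB)|].
have xi : tnth u i = tnth x i.
  by rewrite !tnth_vec upd_neq 1?eq_sym // Bi Ai.
pose B' := upd (upd B j (B j).-1) i (B i).+1.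
have yE : uv A B' = bumpv x i 1.
  apply: eq_from_tnth => k; rewrite !tnth_mktuple /B' /upd.
  by case: (eqVneq k i) => [->|_]; rewrite 1?eq_sym ?(negbTE ji); lia.
have zE : uv A B = bumpv x j 1.
  apply: eq_from_tnth => k; rewrite !tnth_mktuple /upd.
  by case: (eqVneq k j) => [->|_]; lia.
have feas : feasible A B'.
  split; [exact: opt.1.1|have [_ le] := opt.1].
  have := sum_upd B j (B j).-1; have := sum_upd (upd B j (B j).-1) i (B i).+1.
  by rewrite upd_neq 1?eq_sym // -/B'; lia.
apply: (opt.2 _ _ feas); have [jU|jU] := boolP (j \in U).
  apply: better_strict; rewrite yE zE; apply: psi_bumpv => //.
  rewrite (gain_eq one_in xi); apply: lt_trans (gain_1_lt_c _ _) _.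
  by apply: le_lt_trans (gc _ jU); exact: gain_le.
have gj := gain_le one_in (ux j).
have gji : (phi x j 1%N <= phi x i 1%N)%R.
  by rewrite (gain_eq one_in xi) (le_trans gj) ?g1.
split; first exact: psi_move yE zE gji.
move=> zy; constructor 3; split=> //.
(* Indifference makes the gains at [x] equal, which squeezes the gain of [j] at [u]: [j] was a
   maximizer too, and [i] was preferred for its index. *)
have e : phi u j 1%N = phi u i 1%N.
  apply/eqP; rewrite eq_le g1 //= -(gain_eq one_in xi).
  have [yz ind] := G1 one_in one_in gji.
  by rewrite ind.1 // /indifferent yz -yE -zE.
have ij : i < j by rewrite ltn_neqAle (inj_eq val_inj) eq_sym ji tie.
apply: (@lex_gt_first _ _ _ i) => [|k ki]; rewrite !tnth_vec /B' /upd.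
  by rewrite eqxx addnS.
by rewrite -!val_eqE /= !ltn_eqF // (ltn_trans ki).
Qed.

End Exchange.

End Greedy.

(** * Matroid ranks *)

Definition matroid_rank (G : finType) (r : {set G} -> nat) : Prop :=
  [/\ r set0 = 0,
      forall (S : {set G}) g, r S <= r (g |: S) <= (r S).+1
    & forall (S T : {set G}) g, S \subset T ->
        r (g |: T) + r S <= r (g |: S) + r T].

Section MatroidRank.

Variables (G : finType) (r : {set G} -> nat).
Hypothesis rM : matroid_rank r.
Implicit Types (S T : {set G}) (g x y : G).

Lemma set_ind_above S T (Q : {set G} -> Prop) : S \subset T -> Q S ->
  (forall (W : {set G}) g, S \subset W -> g |: W \subset T -> g \notin W -> Q W ->
    Q (g |: W)) -> Q T.
Proof.
move=> ST QS step.
have [k] := ubnP #|T :\: S|; elim: k T ST step => // k IHk T ST step ltk.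
have [/eqP|[g]] := set_0Vmem (T :\: S).
  by rewrite setD_eq0 => TS; rewrite (_ : T = S) //; apply/eqP; rewrite eqEsubset TS.
rewrite inE => /andP[gS gT]; rewrite -(setD1K gT).
have SW : S \subset T :\ g by rewrite subsetD1 ST gS.
apply: (step); rewrite ?setD1K ?inE ?eqxx //.
apply: IHk => // [W h SW' hW hnW QW|].
  by apply: step => //; apply: subset_trans hW (subsetDl _ _).
rewrite -ltnS (leq_trans _ ltk) // ltnS.
rewrite (cardsD1 g (T :\: S)) inE gS gT add1n ltnS subset_leq_card //.
by apply/subsetP => z; rewrite !inE => /and3P[-> -> ->].
Qed.

Lemma rank_mono S T : S \subset T -> r S <= r T.
Proof.
move=> ST; apply: (set_ind_above (Q := fun W => r S <= r W) ST) => // W g _ _ _ le.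
by case: rM => _ /(_ W g)/andP[h _] _; exact: leq_trans h.
Qed.

Lemma rankD S T : S \subset T -> r T <= r S + #|T :\: S|.
Proof.
move=> ST; have : r T + #|S| <= r S + #|T|; last first.
  by rewrite cardsDS //; have := subset_leq_card ST; lia.
apply: (set_ind_above (Q := fun W => r W + #|S| <= r S + #|W|) ST) => //.
move=> W g _ _ gW; rewrite cardsU1 gW.
by case: rM => _ /(_ W g)/andP[_ h] _; lia.
Qed.

Lemma rank_leq_card S : r S <= #|S|.
Proof. by case: rM => r0 _ _; have := rankD (sub0set S); rewrite r0 setD0. Qed.

Lemma indep_sub S T : S \subset T -> r T = #|T| -> r S = #|S|.
Proof.
move=> ST rT; apply/eqP; rewrite eqn_leq rank_leq_card /=.
have := rankD ST; rewrite cardsDS // rT.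
by have := subset_leq_card ST; lia.
Qed.

(** Nested sets of equal rank have the same closure; diminishing returns give the nontrivial
    inequality. *)
Lemma rank_span S T g : S \subset T -> r S = r T -> r (g |: S) = r (g |: T).
Proof.
move=> ST e; apply/eqP; rewrite eqn_leq rank_mono ?setUS //=.
by case: rM => _ _ /(_ S T g ST); rewrite e; lia.
Qed.

Lemma rank_closure S T : S \subset T ->
  (forall g, g \in T -> r (g |: S) = r S) -> r T = r S.
Proof.
move=> ST H; apply: (set_ind_above (Q := fun W => r W = r S) ST) => // W g SW gW _ e.
by rewrite -(@rank_span S W g) ?e // H // (subsetP gW) ?setU11.
Qed.

(* The fundamental circuit of [y] in [S] meets [D] only if some exchange of
   an element of [D] for [y] is possible. *)
Lemma rank_avoid S (D : {set G}) y : r S = #|S| -> D \subset S ->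
  r (y |: S) = r S -> y \notin S ->
  (forall x, x \in D -> r (y |: (S :\ x)) <> r S) ->
  r (y |: (S :\: D)) = r (S :\: D).
Proof.
move=> rS DS yS ynS H.
suff : D \subset S -> r (y |: (S :\: D)) = r (S :\: D) by apply.
apply: (@set_ind_above set0 D (fun D => D \subset S ->
  r (y |: (S :\: D)) = r (S :\: D))) => [|_|W x _ xW xnW IH xWS].
- exact: sub0set.
- by rewrite setD0.
have xS : x \in S by rewrite (subsetP xWS) ?setU11.
have WS : W \subset S by apply: subset_trans xWS; exact: subsetUr.
set A := S :\: W; set B := S :\: (x |: W).
have AB : A = x |: B.
  apply/setP => z; rewrite !inE; case: eqP => [->|]; rewrite ?xnW ?xS //=.
have xB : x \notin B by rewrite !inE eqxx.
have yB : y \notin B by rewrite !inE (negbTE ynS) !andbF.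
have xy : x != y by apply: contraNneq ynS => <-.
have rB : r B = #|B| by apply: indep_sub rS; exact: subsetDl.
have rA : r A = #|A| by apply: indep_sub rS; exact: subsetDl.
have := IH WS; rewrite -/A => {}IH.
have cA : #|A| = #|B|.+1 by rewrite AB cardsU1 xB.
case: rM => _ rI rSub; have /andP[lo hi] := rI B y.
(* Were [y] outside the closure of [B], then [y |: B] would span [A]. So [x] would lie in its
   closure, hence in that of [y |: (S :\ x)], and [x] could be exchanged for [y]. *)
apply/eqP; rewrite eqn_leq lo andbT leqNgt; apply/negP => lt.
have e : r (y |: B) = r (y |: A) by rewrite IH rA cA -rB; lia.
have sub : y |: B \subset y |: A by rewrite setUS // AB subsetUr.
have e2 : r (x |: (y |: B)) = r (y |: B).
  rewrite (rank_span x sub e) setUA [x |: _]setUC -setUA e.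
  by rewrite (_ : x |: A = A) //; apply/setUidPr; rewrite AB sub1set setU11.
have xD : x \in D by rewrite (subsetP xW) ?setU11.
have BSx : y |: B \subset y |: (S :\ x).
  by rewrite setUS // /B setDUr; apply/subsetP => z; rewrite !inE => /andP[->].
have := rSub _ _ x BSx; rewrite e2 [in X in X -> _]setUA [x |: [set y]]setUC.
rewrite -setUA setD1K // yS.
have := @rank_mono (S :\ x) (y |: (S :\ x)) (subsetUr _ _).
have := @rank_mono (y |: (S :\ x)) (y |: S) (setUS _ (subsetDl _ _)).
have := H x xD; lia.
Qed.

End MatroidRank.

(** * Bases of goods worth c in a {1,c}-SUB valuation *)

Section SubValuation.

Variables (R : realType) (G : finType) (c : nat).
Hypothesis c2 : 2 <= c.

(** Goods of [S] are added one by one, and [T] collects those of marginal value [c]. Marginals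
    decrease, so these are worth [c] over the smaller set [T] as well. *)
Lemma val_basis (v : {set G} -> R) (S : {set G}) : SUB c v ->
  exists T : {set G}, [/\ T \subset S, v T = (c * #|T|)%:R%R
    & v S = (#|S| + (c - 1) * #|T|)%:R%R].
Proof.
move=> [_ v0 vm vs].
apply: (@set_ind_above G set0 S (fun S => exists T : {set G},
  [/\ T \subset S, v T = (c * #|T|)%:R%R
    & v S = (#|S| + (c - 1) * #|T|)%:R%R])) => [||W g _ _ gW [T [TW vT vW]]].
- exact: sub0set.
- by exists set0; rewrite sub0set v0 cards0 !muln0.
have gT : g \notin T by apply: contra gW; exact: subsetP.
have E U : v (g |: U) = (v U + marginal v U g)%R by rewrite /marginal addrC subrK.
have [m1|mc] := vm _ _ gW.
  exists T; split; rewrite ?(subset_trans TW) ?subsetUr //.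
  by rewrite E m1 vW cardsU1 gW natr1; congr (_%:R)%R; lia.
exists (g |: T); split; rewrite ?setUS //; last first.
  by rewrite E mc vW !cardsU1 gW gT -natrD; congr (_%:R)%R; lia.
rewrite E vT cardsU1 gT; have [mT|->] := vm _ _ gT; last first.
  by rewrite -natrD; congr (_%:R)%R; lia.
by have := vs _ _ g TW gW; rewrite mT mc lern1; lia.
Qed.

Lemma val_mono (v : {set G} -> R) (S T : {set G}) : SUB c v -> T \subset S ->
  (v T + #|S|%:R <= v S + #|T|%:R)%R.
Proof.
move=> [_ _ vm _] TS; apply: (set_ind_above (Q := fun S => (v T + #|S|%:R <= v S + #|T|%:R)%R) TS)
  => // W g _ _ gW le.
have : (1 <= marginal v W g)%R.
  by case: (vm _ _ gW) => -> //; rewrite ler1n; lia.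
rewrite /marginal cardsU1 gW add1n -natr1 => le'.
by lra.
Qed.

End SubValuation.

(** * Clean allocations and shortest augmenting paths *)

Section CleanAllocations.

Variables (R : realType) (G : finType) (n c : nat).
Variable v : 'I_n -> {set G} -> R.
Hypothesis c2 : 2 <= c.
Hypothesis vSUB : forall i, SUB c (v i).

Implicit Types (X Y : allocation G n) (S T : {set G}) (a : option 'I_n)
  (i j : 'I_n) (g h x y : G).

Local Notation beta := (beta c v).
Local Notation clean := (clean c v).
Local Notation exchange := (exchange c v).
Local Notation F := (F c v).

Lemma leq_beta a S T : T \subset S -> val0 c v a T = (c * #|T|)%:R%R ->
  #|T| <= beta a S.
Proof. by move=> TS /eqP vT; apply: leq_bigmax_cond; rewrite TS. Qed.

Lemma val0_set0 a : val0 c v a set0 = (c * #|@set0 G|)%:R%R.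
Proof.
rewrite cards0 muln0; case: a => [i|] /=; last by rewrite cards0 muln0.
by case: (vSUB i).
Qed.

Lemma beta_basis a S : exists T,
  [/\ T \subset S, val0 c v a T = (c * #|T|)%:R%R & #|T| = beta a S].
Proof.
have [|T] := @eq_bigmax_cond _ [pred T : {set G} | (T \subset S) &&
  (val0 c v a T == (c * #|T|)%:R%R)] (fun T => #|T|).
  by apply/card_gt0P; exists set0; rewrite !inE sub0set val0_set0 eqxx.
by rewrite inE => /andP[TS /eqP vT] e; exists T; split.
Qed.

Lemma beta_None S : beta None S = #|S|.
Proof.
apply/eqP; rewrite eqn_leq [X in _ && X]leq_beta // andbT.
by have [T [TS _ <-]] := beta_basis None S; exact: subset_leq_card.
Qed.

(** The greedy basis [T] is a largest one: [v i] minus cardinality is monotone, so any [T'] in [S]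
    worth [c] per good satisfies [(c - 1) * #|T'| <= (c - 1) * #|T|]. *)
Lemma valE i S : v i S = (#|S| + (c - 1) * beta (Some i) S)%:R%R.
Proof.
have [T [TS vT vS]] := val_basis c2 S (vSUB i).
have [T' [TS' /= vT' eT']] := beta_basis (Some i) S.
rewrite vS; congr (_%:R)%R; congr (_ + _ * _).
have le : #|T| <= beta (Some i) S by exact: leq_beta.
apply/eqP; rewrite eqn_leq le -eT'.
have := val_mono c2 (vSUB i) TS'; rewrite vS vT' -!natrD ler_nat => le'.
have : (c - 1) * #|T'| <= (c - 1) * #|T|.
  by rewrite !mulnBl !mul1n; move: le'; rewrite mulnBl mul1n; lia.
by rewrite leq_pmul2l //; lia.
Qed.

(** Through [valE], marginals 1 and [c] of the valuation become rank increments 0 and 1, and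
    decreasing marginals become submodularity. *)
Lemma beta_rank a : matroid_rank (beta a).
Proof.
case: a => [i|]; last first.
  split=> [|S g|S T g ST]; rewrite !beta_None ?cards0 //.
    by rewrite !cardsU1; case: (g \in S); lia.
  rewrite !cardsU1; have := subsetP ST g.
  by case: (g \in S) (g \in T) => [] [] /=; try lia; move=> /(_ isT).
have [v_ge0 v0 vm vs] := vSUB i.
have E S g : g \notin S -> (marginal (v i) S g +
    ((c - 1) * beta (Some i) S)%:R =
    1 + ((c - 1) * beta (Some i) (g |: S))%:R)%R.
  move=> gS; rewrite /marginal !valE cardsU1 gS add1n !natrD -natr1; lra.
have I S g : beta (Some i) S <= beta (Some i) (g |: S) <= (beta (Some i) S).+1.
  have [gS|/[dup] gS /E] := boolP (g \in S).
    by rewrite (_ : g |: S = S) ?leqnn ?leqnSn //; apply/setUidPr; rewrite sub1set.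
  have [->|->] := vm _ _ gS; rewrite -?natr1 -?natrD.
    move/addrI/eqP; rewrite eqr_nat eqn_pmul2l => [/eqP->|]; last by lia.
    by rewrite leqnn leqnSn.
  rewrite nat1r => /eqP; rewrite eqr_nat => /eqP e.
  have : (c - 1) * (beta (Some i) S).+1 = (c - 1) * beta (Some i) (g |: S).
    by rewrite mulnS; lia.
  by move/eqP; rewrite eqn_pmul2l => [/eqP<-|]; rewrite ?leqnn ?leqnSn //; lia.
split=> // [|S T g ST].
  by have := valE i set0; rewrite v0 cards0 add0n => /esym/eqP; rewrite pnatr_eq0; nia.
have [gT|gT] := boolP (g \in T).
  rewrite (_ : g |: T = T); last by apply/setUidPr; rewrite sub1set.
  by rewrite addnC leq_add2r; case/andP: (I S g).
have gS : g \notin S by apply: contra gT; exact: subsetP.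
have := vs _ _ g ST gT; have := E _ _ gS; have := E _ _ gT => e1 e2 le.
have : (((c - 1) * beta (Some i) (g |: T))%:R + ((c - 1) * beta (Some i) S)%:R <=
  ((c - 1) * beta (Some i) (g |: S))%:R + ((c - 1) * beta (Some i) T)%:R :> R)%R.
  by lra.
by rewrite -!natrD ler_nat -!mulnDr leq_pmul2l //; lia.
Qed.

Lemma clean_sub X Y : clean X ->
  (forall i, bundle Y (Some i) \subset bundle X (Some i)) -> clean Y.
Proof.
move=> cX YX [i|]; last exact: beta_None.
exact: indep_sub (beta_rank _) _ _ (YX i) (cX _).
Qed.

Lemma exchangeE X g h : exchange X g h =
  (beta (X g) (h |: (bundle X (X g) :\ g)) == beta (X g) (bundle X (X g))).
Proof.
apply/existsP/idP => [[j]|H]; last by exists (X g); rewrite inE eqxx.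
by rewrite inE => /andP[/eqP->].
Qed.

Lemma inF i X g : (g \in F i X) =
  (beta (Some i) (g |: bundle X (Some i)) == (beta (Some i) (bundle X (Some i))).+1).
Proof.
rewrite inE; have [_ /(_ (bundle X (Some i)) g) + _] := beta_rank (Some i).
by lia.
Qed.

Lemma notinF i X g : g \notin F i X ->
  beta (Some i) (g |: bundle X (Some i)) = beta (Some i) (bundle X (Some i)).
Proof.
rewrite inF; have [_ /(_ (bundle X (Some i)) g) + _] := beta_rank (Some i).
by lia.
Qed.

(** What shortness of a path is used for, in a form that survives removal of the last vertex. Only
    forward chords are excluded. *)
Definition chordless_path i X (f : nat -> G) k : Prop :=
  [/\ forall s t, s <= k -> t <= k -> f s = f t -> s = t,
      forall s, s <= k -> (f s \in F i X) = (s == 0),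
      forall s t, s < t <= k -> exchange X (f s) (f t) = (t == s.+1)
    & forall s, s <= k -> (X (f s) == None) = (s == k)].

Lemma augment_in X i f k s : (forall s t, s <= k -> t <= k -> f s = f t -> s = t) ->
  s <= k -> augment X i (mkseq f k.+1) (f s) = if s is s'.+1 then X (f s') else Some i.
Proof.
move=> inj sk; have inf : f s \in mkseq f k.+1 by apply: map_f; rewrite mem_iota.
rewrite ffunE inf (_ : index _ _ = s).
  case: s sk {inf} => // s sk.
  rewrite -[LHS]/(nth (X (f s.+1)) (map X (mkseq f k.+1)) s).
  by rewrite (nth_map (f 0)) ?size_mkseq ?nth_mkseq // ltnW.
have /(nth_uniq (f 0)) U : uniq (mkseq f k.+1).
  apply/mkseq_uniqP => s1 s2; rewrite !inE !ltnS; exact: inj.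
by apply/eqP; rewrite -U ?nth_index ?index_mem ?nth_mkseq ?size_mkseq ?ltnS //.
Qed.

Lemma augment_out X i f k h : (forall s, s <= k -> h <> f s) ->
  augment X i (mkseq f k.+1) h = X h.
Proof.
move=> H; rewrite ffunE; case: ifP => // /mapP[s].
by rewrite mem_iota add0n ltnS => /H.
Qed.

Lemma card_bundleU1 X Y a g : X g != a -> bundle Y a = g |: bundle X a ->
  #|bundle Y a| = #|bundle X a|.+1.
Proof. by move=> ga ->; rewrite cardsU1 inE ga. Qed.

(* Swapping the last two goods of a chordless path changes neither the other
   edges out of its vertices nor [F i], because it preserves the span of the
   bundle involved with any of the other path goods removed. *)
Lemma swap_last i X (f : nat -> G) k (x := f k) (y := f k.+1)
    (X' : allocation G n := [ffun h => if h == y then X x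
                        else if h == x then None else X h]) :
  clean X -> chordless_path i X f k.+1 ->
  [/\ clean X', chordless_path i X' f k,
      forall j, #|bundle X' (Some j)| = #|bundle X (Some j)|,
      bundle X' None = x |: (bundle X None :\ y)
    & augment X i (mkseq f k.+2) = augment X' i (mkseq f k.+1)].
Proof.
move=> cX [inj hF hE h0].
have xy : x != y by apply/eqP => /inj; lia.
have Xy : X y = None by apply/eqP; rewrite h0 ?eqxx.
case Xx : (X x) => [j|]; last by have := h0 k; rewrite Xx eqxx; lia.
have X'y : X' y = Some j by rewrite ffunE eqxx.
have X'x : X' x = None by rewrite ffunE (negbTE xy) eqxx.
have X'o h : h != x -> h != y -> X' h = X h by rewrite ffunE => /negbTE-> /negbTE->.
set J := bundle X (Some j); set r := beta (Some j).
have xJ : x \in J by rewrite inE Xx.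
have yJ : y \notin J by rewrite inE Xy.
have bj : bundle X' (Some j) = y |: (J :\ x).
  apply/setP => h; rewrite !inE; have [->|hy] := eqVneq h y; first by rewrite X'y eqxx.
  by have [->|hx] := eqVneq h x; rewrite ?X'x ?X'o.
have bo j' : j' != j -> bundle X' (Some j') = bundle X (Some j').
  move=> jj'; apply/setP => h; rewrite !inE.
  have [->|hy] := eqVneq h y; first by rewrite X'y Xy; apply/eqP => -[/esym/eqP]; apply/negP.
  have [->|hx] := eqVneq h x; last by rewrite X'o.
  by rewrite X'x Xx; apply/esym/eqP => -[/esym/eqP]; apply/negP.
have bN : bundle X' None = x |: (bundle X None :\ y).
  apply/setP => h; rewrite !inE; have [->|hx] := eqVneq h x; first by rewrite X'x.
  by have [->|hy] := eqVneq h y; rewrite ?X'y ?X'o.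
have rM : matroid_rank r := beta_rank _.
have rJ : r J = #|J| := cX _.
have rJ' : r (y |: (J :\ x)) = r J.
  by have := hE k k.+1; rewrite exchangeE Xx eqxx => H; apply/eqP; rewrite H; lia.
have cJ' : #|y |: (J :\ x)| = #|J|.
  by rewrite cardsU1 in_setD1 (negbTE yJ) andbF (cardsD1 x J) xJ.
have cX' : clean X'.
  case=> [j'|]; last exact: beta_None.
  by have [->|jj'] := eqVneq j' j; rewrite ?bj ?cJ' ?bo // -/r rJ'.
(* When [i = j], the good [y] is outside [F i X], so [J] and [y |: (J :\ x)] both have the closure
   of [y |: J]. *)
have FE : F i X' = F i X.
  apply/setP => h; rewrite !inF; have [ij|ij] := eqVneq i j; last by rewrite bo.
  rewrite ij bj -/r -/J rJ'.
  have yF : r (y |: J) = r J.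
    by rewrite /r /J -ij; apply: notinF; rewrite hF.
  rewrite (@rank_span _ r rM (y |: (J :\ x)) (y |: J) h) ?setUS ?subsetDl //.
    by rewrite -(@rank_span _ r rM J (y |: J) h) ?subsetUr.
  by rewrite yF.
have inj' s t : s <= k -> t <= k -> f s = f t -> s = t.
  by move=> sk tk; apply: inj; exact: leqW.
have fx s : s <= k -> (f s == x) = (s == k).
  by move=> sk; apply/eqP/eqP => [/inj'|->] //; apply.
have fy s : s <= k -> (f s == y) = false.
  by move=> sk; apply/eqP => /inj; lia.
split=> //.
- split=> // [s sk|s t /andP[st tk]|s sk].
  + by rewrite FE hF // leqW.
  + rewrite -hE ?st ?leqW // !exchangeE; set w := f s.
    have sk : s <= k by rewrite ltnW // (leq_trans st).
    have wx : w != x by rewrite fx //; lia.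
    have wy : w != y by rewrite fy.
    rewrite X'o //; have [Xw|Xw] := eqVneq (X w) (Some j); last first.
      case Xw' : (X w) Xw => [j'|]; first by rewrite (inj_eq Some_inj) => /bo->.
      by have := h0 s; rewrite -/w Xw' eqxx; lia.
    rewrite Xw bj -/r -/J rJ'.
    have wJ : w \in J by rewrite inE Xw.
    have E : (y |: (J :\ x)) :\ w = y |: ((J :\ w) :\ x).
      apply/setP => h; rewrite !inE; have [->|] := eqVneq h y; last by case: (h == w); rewrite ?andbF.
      by rewrite eq_sym wy.
    have rw : r (J :\ w) = #|J|.-1.
      by rewrite (indep_sub rM _ rJ) ?subsetDl // (cardsD1 w J) wJ.
    (* There is no chord from [w] to [y], so [y] lies in the closure of [J :\ w]. The new bundle
       without [w] has the same rank, hence the same closure. *)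
    have ryw : r (y |: (J :\ w)) = r (J :\ w).
      have ne : r (y |: (J :\ w)) <> r J.
        move=> e; have := hE s k.+1; rewrite exchangeE -/w Xw -/J -/r e eqxx.
        by lia.
      have [_ /(_ (J :\ w) y)/andP[lo hi] _] := rM.
      have J0 : 0 < #|J| by apply/card_gt0P; exists w.
      by apply/eqP; rewrite eqn_leq lo andbT; lia.
    have rE : r ((y |: (J :\ x)) :\ w) = r (J :\ w).
      rewrite (indep_sub rM (subsetDl _ [set w])) ?rJ' ?cJ' // rw -cJ'.
      by rewrite (cardsD1 w (y |: _)) in_setU1 in_setD1 wx wJ orbT.
    rewrite (@rank_span _ r rM _ (y |: (J :\ w)) (f t) _) ?rE ?ryw //.
      by rewrite -(@rank_span _ r rM (J :\ w) _ (f t)) ?subsetUr.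
    by rewrite E setUS // subsetDl.
  + have [->|sk'] := eqVneq s k; first by rewrite X'x.
    by rewrite X'o ?fx ?fy // h0 ?leqW //; apply/negbTE; lia.
- move=> j'; have [->|jj'] := eqVneq j' j; last by rewrite bo.
  by rewrite bj cJ'.
apply/ffunP => h; have [[s sk ->]|H] := pselect (exists2 s, s <= k & h = f s).
  rewrite !augment_in ?leqW //; case: s sk => // s sk.
  by rewrite X'o ?fx ?fy ?(ltnW sk) //; lia.
rewrite [RHS]augment_out => [|s sk hs]; last by apply: H; exists s.
have hx : h != x by apply/eqP => hx; apply: H; exists k.
have [->|hy] := eqVneq h y; first by rewrite augment_in // X'y.
rewrite augment_out ?X'o // => s; rewrite leq_eqVlt => /predU1P[->|sk hs].
  exact/eqP.
by apply: H; exists s.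
Qed.

(** The path is carried out from its unallocated end: each [swap_last] leaves a clean allocation and
    a shorter chordless path, down to a single unallocated good of [F i X]. *)
Lemma augment_chordless i X f k : clean X -> chordless_path i X f k ->
  [/\ clean (augment X i (mkseq f k.+1)),
      forall j, #|bundle (augment X i (mkseq f k.+1)) (Some j)| =
        #|bundle X (Some j)| + (j == i)
    & bundle (augment X i (mkseq f k.+1)) None = bundle X None :\ f k].
Proof.
elim: k X => [|k IHk] X cX chX; last first.
  have [cX' chX' sz bN ->] := swap_last cX chX.
  have [? sz' bN'] := IHk _ cX' chX'; split=> // [j|]; first by rewrite sz' sz.
  rewrite bN' bN; have [_ _ _ h0] := chX.
  apply/setP => h; rewrite !inE; have [->|//] := eqVneq h (f k).
  by rewrite h0 // (ltn_eqF (ltnSn k)) andbF.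
have [inj hF _ h0] := chX; set X' := augment _ _ _.
have X0 : X (f 0) = None by apply/eqP; rewrite h0.
have X'0 : X' (f 0) = Some i by rewrite /X' augment_in.
have X'o h : h != f 0 -> X' h = X h.
  move=> h0'; apply: augment_out => s; rewrite leqn0 => /eqP->.
  exact/eqP.
have bi : bundle X' (Some i) = f 0 |: bundle X (Some i).
  apply/setP => h; rewrite !inE; have [->|hf] := eqVneq h (f 0).
    by rewrite X'0 eqxx.
  by rewrite X'o.
have bo j : j != i -> bundle X' (Some j) = bundle X (Some j).
  move=> ji; apply/setP => h; rewrite !inE; have [->|hf] := eqVneq h (f 0).
    by rewrite X'0 X0; apply/eqP => -[/esym/eqP]; apply/negP.
  by rewrite X'o.
have ci : #|bundle X' (Some i)| = #|bundle X (Some i)|.+1.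
  by apply: card_bundleU1 bi; rewrite X0.
split.
- case=> [j|]; last exact: beta_None.
  have [->|ji] := eqVneq j i; last by rewrite bo.
  by rewrite ci bi -(cX (Some i)); apply/eqP; rewrite -inF hF.
- by move=> j; have [->|ji] := eqVneq j i; rewrite ?ci ?addn1 // bo // addn0.
apply/setP => h; rewrite !inE; have [->|hf] := eqVneq h (f 0).
  by rewrite X'0.
by rewrite X'o.
Qed.

Lemma last_take_nth g (p : seq G) s :
  s <= size p -> last g (take s p) = nth g (g :: p) s.
Proof.
move=> sp; rewrite -nth_last; case: s sp => [|s] sp; first by rewrite take0.
by rewrite size_takel //= nth_take.
Qed.

(** Any violation gives a shorter augmenting path: start at a later vertex of [F i X], stop at an
    earlier unallocated good, or follow a chord. A repeated vertex creates a later vertex of [F i X]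
    or a chord. *)
Lemma shortest_chordless i X g p : shortest_aug_path c v i X g p ->
  chordless_path i X (nth g (g :: p)) (size p).
Proof.
move=> [[gF pe lp] short]; set f := nth g (g :: p).
have lf s : s <= size p -> last g (take s p) = f s by exact: last_take_nth.
have step s : s < size p -> exchange X (f s) (f s.+1).
  by move=> sp; have /pathP := pe; apply.
have hF s : s <= size p -> (f s \in F i X) = (s == 0).
  case: s => [|s] sp; first by rewrite gF.
  apply/negbTE/negP => fF; have := short (f s.+1) (drop s.+1 p).
  rewrite size_drop => H; suff : size p <= size p - s.+1 by lia.
  move: pe lp; rewrite -{1 2}(cat_take_drop s.+1 p) cat_path last_cat lf //.
  by move=> /andP[_ pe] lp; apply: H; split.
have h0 s : s <= size p -> (X (f s) == None) = (s == size p).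
  rewrite leq_eqVlt => /predU1P[->|sp].
    by rewrite eqxx -lf // take_size; move: lp; rewrite inE.
  rewrite (ltn_eqF sp); apply/negbTE/negP => /eqP X0.
  have := short g (take s p); rewrite size_takel ?(ltnW sp) // leqNgt sp => H.
  suff : false by []; apply: H; split=> //; last by rewrite lf ?inE ?X0 // ltnW.
  exact: take_path.
have hE s t : s < t <= size p -> exchange X (f s) (f t) = (t == s.+1).
  case: t => // t; rewrite ltnS eqSS => /andP[st tp]; apply/idP/eqP; last first.
    by move=> e; rewrite -e; apply: step; rewrite e in tp *.
  move=> e; apply/eqP; rewrite eqn_leq st andbT.
  have sp : s <= size p by rewrite (leq_trans st) // ltnW.
  have E : drop t p = f t.+1 :: drop t.+1 p by rewrite (drop_nth g).
  have := short g (take s p ++ drop t p); rewrite size_cat size_takel // size_drop.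
  move=> H; suff : size p <= s + (size p - t) by lia.
  apply: H; split=> //.
    rewrite cat_path take_path // lf // E /= e /=.
    move: pe; rewrite -{1}(cat_take_drop t.+1 p) cat_path lf //.
    by case/andP.
  rewrite last_cat E /=; move: lp; rewrite -{1}(cat_take_drop t.+1 p) last_cat.
  by rewrite lf.
have inj s t : s < t <= size p -> f s <> f t.
  case: s => [|s] /andP[st tp] e.
    by have := hF t tp; rewrite -e gF; lia.
  have := hE s t; rewrite -e step; last by lia.
  by lia.
split=> // s t sk tk e; have [st|ts|//] := ltngtP s t.
  by case: (inj s t) => //; rewrite st.
by case: (inj t s) => //; rewrite ts.
Qed.

Lemma augment_shortest i X g p : clean X -> shortest_aug_path c v i X g p ->
  [/\ clean (augment X i (g :: p)),
      forall j, #|bundle (augment X i (g :: p)) (Some j)| =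
        #|bundle X (Some j)| + (j == i)
    & bundle (augment X i (g :: p)) None = bundle X None :\ last g p].
Proof.
move=> cX /shortest_chordless/(augment_chordless cX).
by rewrite (mkseq_nth g (g :: p)) -last_take_nth // take_size.
Qed.

Lemma exists_shortest i X g p : aug_path c v i X g p ->
  exists h q, shortest_aug_path c v i X h q.
Proof.
have [k] := ubnP (size p); elim: k g p => // k IHk g p ltk gp.
have [[h [q [hq lt]]]|H] :=
  pselect (exists h q, aug_path c v i X h q /\ size q < size p).
  by apply: (IHk h q) => //; rewrite -ltnS (leq_trans _ ltk).
exists g, p; split=> // h q hq; rewrite leqNgt; apply/negP => lt.
by apply: H; exists h, q.
Qed.

End CleanAllocations.

(** * The polymatroid of clean allocations *)

Section Realizable.

Variables (R : realType) (G : finType) (n c : nat).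
Variable v : 'I_n -> {set G} -> R.
Hypothesis c2 : 2 <= c.
Hypothesis vSUB : forall i, SUB c (v i).

Implicit Types (X Y : allocation G n) (i j : 'I_n) (g h : G).

Definition sizes X : 'I_n -> nat := fun i => #|bundle X (Some i)|.

(** Instance of the abstract [P] of the greedy argument. *)
Definition realizable (a : 'I_n -> nat) : Prop :=
  exists X, clean c v X /\ sizes X = a.

Lemma bundle_empty i : bundle ([ffun=> None] : allocation G n) (Some i) = set0.
Proof. by apply/setP => g; rewrite !inE ffunE. Qed.

Lemma clean_empty : clean c v ([ffun=> None] : allocation G n).
Proof.
case=> [i|]; last exact: beta_None.
by rewrite bundle_empty cards0; case: (beta_rank c2 vSUB (Some i)).
Qed.

Lemma sizes_empty : sizes [ffun=> None] = fun=> 0.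
Proof. by apply/funext => i; rewrite /sizes bundle_empty cards0. Qed.

Lemma realizable0 : realizable (fun=> 0).
Proof. by exists [ffun=> None]; split; [exact: clean_empty|exact: sizes_empty]. Qed.

Lemma exists_restriction X (S : 'I_n -> {set G}) :
  (forall i, S i \subset bundle X (Some i)) ->
  exists Y, forall i, bundle Y (Some i) = S i.
Proof.
move=> SX.
exists [ffun g => if X g is Some i then if g \in S i then Some i else None else None].
move=> i; apply/setP => g; rewrite !inE ffunE.
have := subsetP (SX i) g; rewrite inE.
case: (X g) => [j|] XS; last by apply/esym/negP => /XS.
have [->|ji] := eqVneq j i; first by case: ifP => //; rewrite eqxx.
have -> : (g \in S i) = false by apply/negP => /XS/eqP[/eqP]; apply/negP.
by case: ifP => // _; apply/eqP => -[/eqP]; apply/negP.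
Qed.

Lemma realizable_down (a A : 'I_n -> nat) :
  (forall i, a i <= A i) -> realizable A -> realizable a.
Proof.
move=> aA [X [cX XA]].
pose S i := [set g in take (a i) (enum (bundle X (Some i)))].
have SX i : S i \subset bundle X (Some i).
  by apply/subsetP => g; rewrite inE => /mem_take; rewrite mem_enum.
have [Y YS] := exists_restriction SX.
exists Y; split; first by apply: (clean_sub c2 vSUB cX) => i; rewrite YS.
apply/funext => i; rewrite /sizes YS cardsE (card_uniqP _) ?take_uniq ?enum_uniq //.
by rewrite size_takel // -cardE -/(sizes X i) XA.
Qed.

Lemma realizable_beta X :
  realizable (fun i => beta c v (Some i) (bundle X (Some i))).
Proof.
have ex i := cid (beta_basis vSUB (Some i) (bundle X (Some i))).
have SX i : sval (ex i) \subset bundle X (Some i) by case: (svalP (ex i)).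
have [Y YS] := exists_restriction SX; exists Y; split.
  case=> [i|]; last exact: beta_None.
  have [_ vT _] := svalP (ex i); rewrite YS; apply/eqP.
  by rewrite eqn_leq leq_beta // (rank_leq_card (beta_rank c2 vSUB (Some i))).
by apply/funext => i; rewrite /sizes YS; case: (svalP (ex i)).
Qed.

Lemma aug_path_realizable i X g p : clean c v X -> aug_path c v i X g p ->
  realizable (upd (sizes X) i (sizes X i).+1).
Proof.
move=> cX /exists_shortest[h [q /(augment_shortest c2 vSUB cX)[cX' sz _]]].
exists (augment X i (h :: q)); split=> //; apply/funext => j.
rewrite /sizes sz /upd; case: (eqVneq j i) => [->|_]; last by rewrite addn0.
by rewrite addn1.
Qed.

(** The sum is split at [Z], the goods reachable from agents of [T]. In [X] all of [Z] belongs to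
    [T], which no [Y] can surpass; outside [Z], each [X_i] with [i] in [T] spans every good, so an
    independent bundle there is no larger. *)
Lemma realizable_sat_clean X (T := [set i | `[< forall g p, ~ aug_path c v i X g p >]]) Y :
  clean c v X -> clean c v Y -> \sum_(i in T) sizes Y i <= \sum_(i in T) sizes X i.
Proof.
move=> cX cY.
pose Z := [set h | [exists i in T, [exists g in F c v i X,
  connect (exchange c v X) g h]]].
have inZ h : h \in Z -> exists i g p, [/\ i \in T, g \in F c v i X,
    path (exchange c v X) g p & h = last g p].
  rewrite inE => /existsP[i /andP[iT /existsP[g /andP[gF /connectP[p gp hp]]]]].
  by exists i, g, p.
have TE i : i \in T -> forall g p, ~ aug_path c v i X g p.
  by rewrite inE => /asboolP.
have ZX h : h \in Z -> exists2 i, i \in T & X h = Some i.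
  move=> /inZ[i [g [p [iT gF gp hE]]]].
  case Xh : (X h) => [j|]; last first.
    by case: (TE _ iT g p); split; rewrite // -hE inE Xh.
  (* An augmenting path of the owner [j] of [h] would extend the path to [h]: [g'] is independent of
     the bundle of [j], so [h] can be exchanged for it. *)
  exists j => //; rewrite inE; apply/asboolP => g' p' [gF' gp' lp'].
  apply: (TE _ iT g (p ++ g' :: p')); split; rewrite ?last_cat //.
  rewrite cat_path gp -hE /= gp' andbT exchangeE Xh.
  have rM := beta_rank c2 vSUB (Some j); rewrite inF // in gF'.
  set r := beta c v (Some j) in rM gF' *; set J := bundle X (Some j) in gF' *.
  have rJ : r J = #|J| := cX _.
  have hJ : h \in J by rewrite inE Xh.
  have g'J : g' \notin J.
    apply: contraTN gF' => g'J; rewrite (_ : g' |: J = J) ?ltn_eqF //.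
    by apply/setUidPr; rewrite sub1set.
  have rgJ : r (g' |: J) = #|g' |: J| by rewrite cardsU1 g'J (eqP gF') rJ.
  rewrite (indep_sub rM _ rgJ) ?setUS ?subsetDl // rJ.
  by rewrite cardsU1 in_setD1 (negbTE g'J) andbF (cardsD1 h J) hJ.
have sat i : i \in T -> #|bundle Y (Some i) :\: Z| <= #|bundle X (Some i) :\: Z|.
  move=> iT; have rM := beta_rank c2 vSUB (Some i).
  set r := beta c v (Some i) in rM; set J := bundle X (Some i).
  have rJ : r J = #|J| := cX _.
  rewrite -(indep_sub rM (subsetDl _ Z) (cY (Some i))).
  rewrite -(indep_sub rM (subsetDl _ Z) rJ).
  (* A good outside [Z] is neither in [F i X] nor the head of an edge from [J :&: Z], so
     [rank_avoid] puts it in the closure of [J :\: Z]. *)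
  rewrite -(@rank_closure _ r rM (J :\: Z) (~: Z)) ?setDE ?subsetIr //.
    by apply: (rank_mono rM); exact: subsetIr.
  move=> y; rewrite inE -setDE => yZ; have [yJ|yJ] := boolP (y \in J).
    congr r; apply/setUidPr; rewrite sub1set inE yZ yJ //.
  have e : J :\: (J :&: Z) = J :\: Z by rewrite setDIr setDv set0U.
  rewrite -e; apply: (rank_avoid rM) => //; first exact: subsetIl.
    apply: (notinF c2 vSUB); apply: contra yZ => yF.
    rewrite inE; apply/existsP; exists i; rewrite iT.
    by apply/existsP; exists y; rewrite yF connect0.
  move=> x; rewrite inE => /andP[xJ /inZ[i' [g [p [i'T gF gp xE]]]]] E.
  case/negP: yZ; rewrite inE; apply/existsP; exists i'; rewrite i'T.
  apply/existsP; exists g; rewrite gF /=; apply/connectP; exists (rcons p y).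
    rewrite rcons_path gp -xE /= exchangeE.
    by move: xJ; rewrite inE => /eqP->; rewrite -/r -/J E.
  by rewrite last_rcons.
have double W : \sum_(i in T) #|bundle W (Some i) :&: Z| =
    \sum_(h in Z) \sum_(i in T) (W h == Some i).
  rewrite exchange_big; apply: eq_bigr => i _ /=.
  rewrite -sum1_card big_mkcond [RHS]big_mkcond; apply: eq_bigr => h _ /=.
  by rewrite in_setI [h \in bundle _ _]inE; case: eqP; case: (h \in Z).
have split W : \sum_(i in T) sizes W i = \sum_(i in T) #|bundle W (Some i) :&: Z|
    + \sum_(i in T) #|bundle W (Some i) :\: Z|.
  by rewrite -big_split; apply: eq_bigr => i _; rewrite /= cardsID.
rewrite !split; apply: leq_add; last exact: leq_sum.
rewrite !double; apply: leq_sum => h /ZX[i iT Xh].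
apply: (@leq_trans 1); last by rewrite (bigD1 i) //= Xh eqxx.
case Yh : (Y h) => [j|]; last by rewrite big1.
rewrite big_mkcond (bigD1 j) //= big1 ?addn0 => [|k kj]; last first.
  by rewrite (inj_eq Some_inj) eq_sym (negbTE kj) if_same.
by case: ifP => // _; exact: leq_b1.
Qed.

Lemma realizable_sat a : realizable a -> exists T : {set 'I_n},
  (forall i, i \notin T -> realizable (upd a i (a i).+1)) /\
  (forall A, realizable A -> \sum_(i in T) A i <= \sum_(i in T) a i).
Proof.
move=> [X [cX <-]].
exists [set i | `[< forall g p, ~ aug_path c v i X g p >]]; split; last first.
  by move=> A [Y [cY <-]]; exact: realizable_sat_clean.
move=> i; rewrite inE => /asboolPn/existsNP[g /existsNP[p /contrapT gp]].
exact: aug_path_realizable gp.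
Qed.

(** [i] belongs to the tight set of [X], so raising its size alone would break the bound of
    [realizable_sat_clean]. *)
Lemma no_aug_path_saturated i X : clean c v X ->
  (forall g p, ~ aug_path c v i X g p) ->
  ~ realizable (upd (sizes X) i (sizes X i).+1).
Proof.
move=> cX no [Y [cY YX]]; have := realizable_sat_clean cX cY.
apply/negP; rewrite -ltnNge; have iT : i \in [set i | `[< forall g p, ~ aug_path c v i X g p >]].
  by rewrite inE; apply/asboolP.
rewrite (bigD1 i) //= [ltnRHS](bigD1 i) //= YX /upd eqxx addSn ltnS.
rewrite leq_add2l; apply: leq_sum => j /andP[_ ji].
by rewrite (negbTE ji).
Qed.

(* The goods in [X1] are worthless beyond 1 to their owner, because the rank
   of the clean bundle of the owner can no longer grow. *)
Lemma utility_union X X1 : clean c v X ->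
  (forall g, X1 g <> None -> X g = None) ->
  (forall i, sizes X1 i <> 0 -> ~ realizable (upd (sizes X) i (sizes X i).+1)) ->
  forall i, beta c v (Some i) (bundle (alloc_union X X1) (Some i)) = sizes X i /\
    tnth (utility v (alloc_union X X1)) i = c * sizes X i + sizes X1 i.
Proof.
move=> cX X1X sat i.
have bE : bundle (alloc_union X X1) (Some i) =
    bundle X (Some i) :|: bundle X1 (Some i).
  apply/setP => g; rewrite !inE ffunE; case Xg : (X g) => [j|//].
  case X1g : (X1 g) => [k|]; last by rewrite orbF.
  by have : X g = None by [apply: X1X; rewrite X1g]; rewrite Xg.
have dis : [disjoint bundle X (Some i) & bundle X1 (Some i)].
  rewrite disjoint_subset; apply/subsetP => g; rewrite !inE => /eqP Xg.
  by apply/eqP => X1g; have : X g = None by [apply: X1X; rewrite X1g]; rewrite Xg.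
have rE : beta c v (Some i) (bundle (alloc_union X X1) (Some i)) = sizes X i.
  rewrite -[RHS](cX (Some i)) bE.
  apply: (rank_closure (beta_rank c2 vSUB (Some i))); first exact: subsetUl.
  move=> g; rewrite inE => /orP[gX|gX1].
    by congr (beta _ _ _ _); apply/setUidPr; rewrite sub1set.
  apply: (notinF c2 vSUB); apply/negP => gF; apply: (sat i).
    by apply/eqP; rewrite -lt0n; apply/card_gt0P; exists g.
  (* A good of [X1] is unallocated in [X]; in [F i X] it would be an augmenting path by itself. *)
  apply: (@aug_path_realizable i X g [::]) => //; split => //=.
  by move: gX1; rewrite !inE => /eqP X1g; rewrite X1X // X1g.
split=> //; apply/eqP; rewrite -(eqr_nat R) (utilityE _ (vSUB i)).
rewrite (valE c2 vSUB) rE eqr_nat bE cardsU.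
rewrite (_ : _ :&: _ = set0) ?cards0 ?subn0; last by apply/eqP; rewrite setI_eq0.
by rewrite -/(sizes X i) -/(sizes X1 i) mulnBl mul1n; apply/eqP; nia.
Qed.

End Realizable.

(** * The algorithm *)

Section Algorithm.

Variables (R : realType) (G : finType) (n c : nat).
Variable v : 'I_n -> {set G} -> R.
Variables (psi : rel (n.-tuple nat)) (phi : gain_function R n).
Hypothesis n0 : 0 < n.
Hypothesis c2 : 2 <= c.
Hypothesis vSUB : forall i, SUB c (v i).
Hypothesis psiJ : justice_criterion psi.
Hypothesis psiC1 : cond_C1 psi.
Hypothesis psiC2 : cond_C2 c psi phi.

Implicit Types (X Y : allocation G n) (i j : 'I_n) (g h : G) (s : state G n).

Local Notation realizable := (realizable c v).

Lemma sum_sizes X : \sum_i sizes X i + #|bundle X None| = #|G|.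
Proof.
rewrite -[RHS]sum1_card (partition_big X predT) //= (bigD1 None) //= addnC.
congr (_ + _); first by rewrite -sum1_card; apply: eq_bigl => g; rewrite inE.
rewrite (reindex_omap Some id) => [|[i|]] //=.
apply: eq_big => [i|i _]; first by rewrite eqxx.
by rewrite /sizes -sum1_card; apply: eq_bigl => g; rewrite inE.
Qed.

Definition free s : {set G} := [set g | (st_c s g == None) && (st_1 s g == None)].

Definition invariant s : Prop :=
  [/\ clean c v (st_c s),
      forall g, st_1 s g <> None -> st_c s g = None,
      forall i, i \notin st_U s ->
        ~ realizable (upd (sizes (st_c s)) i (sizes (st_c s) i).+1)
    & forall i, i \in st_U s -> sizes (st_1 s) i = 0].

Lemma card_unallocated s : invariant s ->
  #|bundle (st_c s) None| = \sum_i sizes (st_1 s) i + #|free s|.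
Proof.
case=> _ X1X _ _; have := sum_sizes (st_1 s).
rewrite -(cardsC (bundle (st_1 s) None)) addnC => /addnI->.
rewrite -(cardsID (bundle (st_1 s) None)) addnC; congr (_ + _).
  apply: eq_card => g; rewrite !inE; case: eqP => //= ng.
  by rewrite X1X ?eqxx.
by apply: eq_card => g; rewrite !inE.
Qed.

Lemma sum_free s : invariant s ->
  \sum_i sizes (st_c s) i + \sum_i sizes (st_1 s) i + #|free s| = #|G|.
Proof. by move=> /card_unallocated e; rewrite -(sum_sizes (st_c s)) e addnA. Qed.

Lemma runningE s : invariant s -> running s = (0 < #|free s|).
Proof.
by move=> /card_unallocated e; rewrite /running e -{1}[X in X < _]addn0 ltn_add2l.
Qed.

Lemma output_clean s : invariant s -> forall i,
  beta c v (Some i) (bundle (output s) (Some i)) = sizes (st_c s) i /\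
  tnth (utility v (output s)) i = c * sizes (st_c s) i + sizes (st_1 s) i.
Proof.
move=> [cX X1X sat U0]; apply: utility_union => // i bi.
by apply: sat; apply/negP => /U0.
Qed.

Lemma utility_output s : invariant s ->
  utility v (output s) = uv c (sizes (st_c s)) (sizes (st_1 s)).
Proof.
move=> /output_clean inv; apply: eq_from_tnth => i; rewrite [RHS]tnth_vec.
by case: (inv i).
Qed.

Lemma le_max_gain s (A : {set 'I_n}) d i : i \in A ->
  ((gain v phi s i d)%:E <= max_gain v phi s A d)%E.
Proof. by move=> iA; apply: (le_bigmax_cond _ (fun k => (gain v phi s k d)%:E)). Qed.

Lemma exists_selected s (A : {set 'I_n}) d : A != set0 -> exists i, selected v phi s A d i.
Proof.
move=> /set0Pn[i0 i0A].
have e : max_gain v phi s A d = (gain v phi s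
    [arg max_(i > i0 in A) (gain v phi s i d)%:E]%O d)%:E.
  by apply: bigmax_eq_arg => // i _; exact: leNye.
pose Q := [pred i | (i \in A) && ((gain v phi s i d)%:E == max_gain v phi s A d)].
have [j Qj] : exists j, Q j.
  move: e; case: arg_maxP => // j jA _ e; exists j; rewrite /= jA.
  by rewrite e eqxx.
have [i /andP[iA /eqP gi] min] := arg_minnP (fun i : 'I_n => i : nat) Qj.
exists i; split=> // k kA gk.
by apply: min; rewrite /= kA gk eqxx.
Qed.

Lemma selected_max s A d i : selected v phi s A d i ->
  (forall k, k \in A -> (gain v phi s k d <= gain v phi s i d)%R) /\
  (forall k, k \in A -> gain v phi s k d = gain v phi s i d -> (i <= k)%N).
Proof.
move=> [iA gi min]; split=> k kA; first by rewrite -lee_fin gi le_max_gain.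
by move=> e; apply: min => //; rewrite e.
Qed.

Lemma exists_refill s g : running s -> invariant s ->
  exists X1', refill s g X1'.
Proof.
move=> run inv; rewrite /refill; case: (st_1 s g) => [j|]; last by eexists.
move: run; rewrite runningE // => /card_gt0P[h]; rewrite inE => /andP[/eqP h1 /eqP h2].
by exists (reassign (reassign (st_1 s) g None) h (Some j)); exists h.
Qed.

Lemma refill_sizes s g X1' : invariant s -> refill s g X1' ->
  sizes X1' = sizes (st_1 s) /\
  forall h, X1' h <> None -> st_c s h = None /\ h <> g.
Proof.
move=> [_ X1X _ _]; rewrite /refill.
case E : (st_1 s g) => [j|] => [[h [ch oh] ->]|->]; last first.
  by split=> // h hn; split; [exact: X1X|move=> hg; rewrite hg E in hn].
have gh : g != h by apply: contra_eqN oh => /eqP <-; rewrite E.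
split; last first.
  move=> k; rewrite !ffunE; case: (eqVneq k h) => [-> _|kh].
    by split=> //; apply/eqP; rewrite eq_sym.
  by case: (eqVneq k g) => // kg /X1X; split=> //; exact/eqP.
apply/funext => i; rewrite /sizes; have [->|ij] := eqVneq i j.
  have -> : bundle (reassign (reassign (st_1 s) g None) h (Some j)) (Some j) =
      h |: (bundle (st_1 s) (Some j) :\ g).
    apply/setP => k; rewrite !inE !ffunE.
    by case: (eqVneq k h) => [_|kh]; rewrite ?eqxx //; case: (eqVneq k g).
  rewrite cardsU1 !inE oh andbF (cardsD1 g (bundle (st_1 s) _)) inE E eqxx.
  by [].
apply: eq_card => k; rewrite !inE !ffunE.
case: (eqVneq k h) => [->|kh].
  by rewrite oh (inj_eq Some_inj) [j == i]eq_sym (negbTE ij).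
case: (eqVneq k g) => [->|//].
by rewrite E (inj_eq Some_inj) [j == i]eq_sym (negbTE ij).
Qed.

Definition below (A B : 'I_n -> nat) s : Prop :=
  forall k, sizes (st_c s) k <= A k /\ sizes (st_1 s) k <= B k.

(** The greedy lemmas keep the state below [(A, B)]. The measure drops because a step consumes a
    free good or discards an agent. *)
Lemma invariant_step A B s s' : optimal c #|G| psi realizable A B ->
  invariant s -> below A B s -> step c v phi s s' ->
  [/\ invariant s', below A B s' & #|free s'| + #|st_U s'| < #|free s| + #|st_U s|].
Proof.
move=> opt inv bel st; have [cX X1X sat U0] := inv.
have sumf := sum_free inv; have uE := utility_output inv.
have run : running s by case: st.
have notfull : \sum_i sizes (st_c s) i + \sum_i sizes (st_1 s) i < #|G|.
  by move: run; rewrite runningE // -sumf; lia.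
have aA k : sizes (st_c s) k <= A k by case: (bel k).
have bB k : sizes (st_1 s) k <= B k by case: (bel k).
have down := fun a A => @realizable_down R G n c v c2 vSUB a A.
have satP := @realizable_sat R G n c v c2 vSUB.
case: st => {s'} [i g p X1' _ gains sel short fill|i _ gains sel noaug|i g _ gains sel [fc f1]].
- have [cX' sz bN] := augment_shortest c2 vSUB cX short.
  have [sz1 X1X'] := refill_sizes inv fill.
  have [iU _ _] := sel; have [max tie] := selected_max sel.
  have szE : sizes (augment (st_c s) i (g :: p)) =
      upd (sizes (st_c s)) i (sizes (st_c s) i).+1.
    apply/funext => k; rewrite /sizes sz /upd.
    by case: (eqVneq k i) => [->|_]; rewrite ?addn1 ?addn0.
  have inv' : invariant (State (augment (st_c s) i (g :: p)) X1' (st_U s)).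
    split=> //= [h /X1X'[ch /eqP hl]|k kU|k kU]; last by rewrite sz1 U0.
      by apply/eqP; have /setP/(_ h) := bN; rewrite !inE ch hl eqxx => ->.
    (* Sizes only grow and [realizable] is closed downwards, so saturation persists. *)
    move=> H; apply: (sat k kU); apply: down H => l; rewrite szE /upd.
    by case: (eqVneq l k) => _; case: eqP => // ->.
  split=> //.
    move=> k; rewrite /= sz1 szE; split=> //; rewrite /upd.
    case: eqP => // ->; rewrite /gain uE in max tie.
    apply: (greedy_c c2 psiJ psiC1 psiC2 down satP n0 opt aA bB U0 sat notfull iU) => //.
      by have [gp _] := short; exact: (aug_path_realizable c2 vSUB cX gp).
    move=> l lU; rewrite -uE -lee_fin.
    have [_ -> _] := sel; apply: le_trans gains.
    by apply: le_max_gain; rewrite inE.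
  rewrite /= ltn_add2r; have := sum_free inv'; rewrite /= sz1 szE sum_updS.
  by rewrite -sumf !addSn => /eqP; rewrite -addnS eqn_add2l => /eqP<-.
- have [iU _ _] := sel; split=> //=; last first.
    by rewrite (cardsD1 i (st_U s)) iU; rewrite add1n addnS ltnS.
  split=> //= k; rewrite !inE; last by case/andP => _; exact: U0.
  case: (eqVneq k i) => [-> _|_ kU]; last exact: sat.
  exact: no_aug_path_saturated.
have [iU _ _] := sel; have [max tie] := selected_max sel.
rewrite inE in iU.
have szE : sizes (reassign (st_1 s) g (Some i)) =
    upd (sizes (st_1 s)) i (sizes (st_1 s) i).+1.
  apply/funext => k; rewrite /sizes /upd; case: (eqVneq k i) => [->|ki].
    have -> : bundle (reassign (st_1 s) g (Some i)) (Some i) =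
        g |: bundle (st_1 s) (Some i).
      apply/setP => h; rewrite !inE ffunE; case: (eqVneq h g) => // _.
      by rewrite eqxx.
    by rewrite cardsU1 inE f1.
  apply: eq_card => h; rewrite !inE ffunE; case: (eqVneq h g) => [->|//].
  by rewrite f1 (inj_eq Some_inj) [i == k]eq_sym (negbTE ki).
have inv' : invariant (State (st_c s) (reassign (st_1 s) g (Some i)) (st_U s)).
  split=> //= [h|k kU]; first by rewrite ffunE; case: eqP => [->|_ /X1X].
  rewrite szE /upd; case: eqP => [ki|_]; last exact: U0.
  by rewrite ki (negbTE iU) in kU.
split=> //.
  move=> k; rewrite /= szE; split=> //; rewrite /upd.
  case: eqP => // ->; rewrite /gain uE in max tie.
  apply: (greedy_1 c2 psiC1 psiC2 down n0 opt aA bB sat notfull iU).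
  - by move=> l lU; apply: max; rewrite inE.
  - by move=> l lU; apply: tie; rewrite inE.
  move=> l lU; rewrite -uE -lte_fin.
  by have [_ -> _] := sel; apply: le_lt_trans gains; exact: le_max_gain.
rewrite /= ltn_add2r; have := sum_free inv'; rewrite /= szE sum_updS.
by rewrite -sumf addnS addSn => /eqP; rewrite -addnS eqn_add2l => /eqP<-.
Qed.

Lemma invariant_init : invariant (init G n).
Proof.
split=> /= [|g|i|i _]; first exact: clean_empty.
- by rewrite ffunE.
- by rewrite inE.
by rewrite sizes_empty.
Qed.

Lemma progress s : invariant s -> running s -> exists s', step c v phi s s'.
Proof.
move=> inv run.
have max0 d : max_gain v phi s set0 d = -oo%E by rewrite /max_gain big_set0.
have [le|lt] := leP (Gain_1 v phi s) (Gain_c c v phi s).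
  (* If [U] were empty, [Gain_c] would be infinite negative, while [n0] makes [Gain_1] a real
     number. *)
  have U0 : st_U s != set0.
    apply/eqP => U0; move: le; rewrite /Gain_1 /Gain_c U0 max0 setC0.
    rewrite leNgt => /negP; apply.
    apply: lt_le_trans (ltNyr (gain v phi s (Ordinal n0) 1)) _.
    by apply: le_max_gain; rewrite inE.
  have [i sel] := exists_selected s c U0.
  have [[g [p gp]]|no] := pselect (exists g p, aug_path c v i (st_c s) g p).
    have [h [q short]] := exists_shortest gp.
    have [X1' fill] := exists_refill (last h q) run inv.
    by eexists; exact: step_augment short fill.
  eexists; apply: step_discard sel _ => // g p gp.
  by apply: no; exists g, p.
have U0 : ~: st_U s != set0.
  apply/eqP => U0; move: lt; rewrite /Gain_1 U0 max0.
  by rewrite ltNge leNye.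
have [i sel] := exists_selected s 1 U0.
move: (run); rewrite runningE // => /card_gt0P[g]; rewrite inE => /andP[/eqP fc /eqP f1].
by eexists; apply: (@step_one _ _ _ _ _ _ _ i g).
Qed.

Lemma clean_utility X : clean c v X -> utility v X = uv c (sizes X) (fun=> 0).
Proof.
move=> cX; apply: eq_from_tnth => i; rewrite [RHS]tnth_vec addn0.
apply/eqP; rewrite -(eqr_nat R) (utilityE _ (vSUB i)) (valE c2 vSUB) (cX (Some i)).
by rewrite eqr_nat -/(sizes X i) mulnBl mul1n; apply/eqP; nia.
Qed.

Lemma decomposition_sizes X Xc X1 : decomposition c v X Xc X1 ->
  sizes Xc = fun i => beta c v (Some i) (bundle X (Some i)).
Proof. by move=> [_ H]; apply/funext => i; case: (H i). Qed.

(** Every allocation projects to a feasible pair by separating its rank from the remaining goods.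
    Utilities and domination depend only on that pair, so an allocation beating [X] would give a
    pair better than [(A, B)]. *)
Lemma optimal_dominating A B X : optimal c #|G| psi realizable A B ->
  utility v X = uv c A B ->
  (forall i, beta c v (Some i) (bundle X (Some i)) = A i) ->
  dominating_psi_maximizing c v psi X.
Proof.
move=> [_ opt] uX bX.
pose a Y := fun i => beta c v (Some i) (bundle Y (Some i)).
pose b Y := fun i => #|bundle Y (Some i)| - a Y i.
have aY Y i : a Y i <= #|bundle Y (Some i)|.
  exact: rank_leq_card (beta_rank c2 vSUB (Some i)) _.
have uY Y : utility v Y = uv c (a Y) (b Y).
  apply: eq_from_tnth => i; rewrite [RHS]tnth_vec.
  apply/eqP; rewrite -(eqr_nat R) (utilityE _ (vSUB i)) (valE c2 vSUB).
  by rewrite eqr_nat -/(a Y i) /b mulnBl mul1n; apply/eqP; have := aY Y i; nia.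
have feas Y : feasible #|G| realizable (a Y) (b Y).
  split; first exact: realizable_beta.
  rewrite -big_split /= -(sum_sizes Y) (leq_trans _ (leq_addr _ _)) //.
  by apply: leq_sum => i _; rewrite /b subnKC.
split=> [Y|Y _ maxY [Yc [Y1 [Xc [X1 [dY dX D]]]]]].
  rewrite uX uY => st; apply: (opt _ _ (feas Y)); exact: better_strict.
apply: (opt _ _ (feas Y)); split=> [|_].
  have := maxY X; rewrite uX uY /strictly; case/orP: (psiJ.1 (uv c (a Y) (b Y)) (uv c A B)) => // h.
  by rewrite h /= => /negP; rewrite negbK.
have sY := decomposition_sizes dY; have sX := decomposition_sizes dX.
have eX : sizes Xc = A by rewrite sX; apply/funext.
have [cY _] := dY; have [cXc _] := dX.
move: D; rewrite /sorted_utility (clean_utility cY) (clean_utility cXc) sY eX uX uY.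
by case=> D; [constructor 1|constructor 2|constructor 3].
Qed.

Lemma BYS_correct : BYS_outputs c v phi (dominating_psi_maximizing c v psi).
Proof.
(* The optimum is fixed before the run, so all runs, whatever their choices, end with the same two
   size vectors. *)
have [A [B opt]] := exists_optimal c #|G| psiJ
  (fun a A => @realizable_down R G n c v c2 vSUB a A) (realizable0 c2 vSUB).
have reach s : reachable c v phi s -> invariant s /\ below A B s.
  have inv0 : invariant (init G n) /\ below A B (init G n).
    by split; [exact: invariant_init|move=> k; rewrite /= !sizes_empty].
  move=> rs; elim: rs inv0 => // [s1 s2 st [inv bel]|s1 s2 s3 _ IH1 _ IH2 /IH1/IH2//].
  by have [] := invariant_step opt inv bel st.
split.
- by move=> s /reach[inv _] run; exact: progress.
- move=> [r [r0 rS]].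
  have rr k : reachable c v phi (r k).
    elim: k => [|k IHk]; first by rewrite r0; exact: rt_refl.
    by apply: rt_trans IHk _; exact/rt_step.
  pose mu k := #|free (r k)| + #|st_U (r k)|.
  have dec k : mu k.+1 < mu k.
    have [inv bel] := reach _ (rr k).
    by have [] := invariant_step opt inv bel (rS k).
  have bound k : mu k + k <= mu 0.
    by elim: k => [|k IHk]; [rewrite addn0|have := dec k; lia].
  by have := bound (mu 0).+1; lia.
move=> s /reach[inv bel]; rewrite runningE // -leqNgt leqn0 => /eqP free0.
have sumf := sum_free inv; rewrite free0 addn0 in sumf.
have [[_ leG] _] := opt.
have leA : \sum_i sizes (st_c s) i <= \sum_i A i by apply: leq_sum => k _; case: (bel k).
have leB : \sum_i sizes (st_1 s) i <= \sum_i B i by apply: leq_sum => k _; case: (bel k).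
have eqs (f g : 'I_n -> nat) : (forall k, f k <= g k) -> \sum_k g k <= \sum_k f k -> f = g.
  move=> le ge; apply/funext => k; apply/eqP; rewrite eqn_leq le leqNgt.
  apply/negP => lt; move: ge; rewrite leqNgt => /negP; apply.
  rewrite (bigD1 k) //= [ltnRHS](bigD1 k) //= -addSn leq_add //.
  exact: leq_sum.
have eA : sizes (st_c s) = A by apply: eqs => [k|]; [case: (bel k)|lia].
have eB : sizes (st_1 s) = B by apply: eqs => [k|]; [case: (bel k)|lia].
apply: (optimal_dominating opt); first by rewrite utility_output // eA eB.
by move=> i; rewrite -eA; case: (output_clean inv i).
Qed.

End Algorithm.

Theorem theorem4p2 (R : realType) (G : finType) (n c : nat)
    (v : 'I_n -> {set G} -> R)
    (psi : rel (n.-tuple nat)) (phi : gain_function R n) :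
  (0 < n)%N ->
  (2 <= c)%N ->
  (forall i : 'I_n, SUB c (v i)) ->
  justice_criterion psi ->
  cond_C1 psi ->
  cond_C2 c psi phi ->
  BYS_outputs c v phi (dominating_psi_maximizing c v psi).
Proof. by move=> n0 c2 vSUB psiJ psiC1 psiC2; exact: BYS_correct. Qed.
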